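(* Let $k,d$ be integers such that $k\geq 4$ and $2k/5<d\le k-1$. There exists $s_0=s_0(k,d)$ such that, for any integer $n$ with $n\ge 2k^2$ and every rational $s$ with $s_0<s\le n/k$, $$f_d^{s}(k,n)=\binom{n-d}{k-d}-\binom{n-d-(\lceil s\rceil-1)}{k-d}+1.$$ Actually, one can take $s_0(k,d)=0$ when $d\ge k/2$, and $s_0(k,d)=1$ when $2k/5<d<k/2$.
   Context: A $k$-graph ($k$-uniform hypergraph) $H$ consists of a finite vertex set $V(H)$ and an edge set $E(H)\subseteq\binom{V(H)}{k}$, where $\binom{S}{k}$ denotes the set of $k$-element subsets of $S$. For $S\subseteq V(H)$, let $N_H(S)=\{T\subseteq V(H)\setminus S: T\cup S\in E(H)\}$ and $d_H(S)=|N_H(S)|$. For an integer $d\ge 0$, the minimum $d$-degree of $H$ is $\delta_d(H)=\min\{d_H(S): S\in\binom{V(H)}{d}\}$. A fractional matching in $H$ is a function $f:E(H)\to[0,1]$ such that $\sum_{e\in E(H):\,v\in e}f(e)\le 1$ for each $v\in V(H)$; its size is $\sum_{e\in E(H)}f(e)$. For integers $n,k,d$ and a positive rational number $s$ with $0\le d\le k-1$ and $s\le n/k$, $f_d^s(k,n)$ denotes the minimum integer $m$ such that every $k$-graph $H$ on $n$ vertices with $\delta_d(H)\ge m$ has a fractional matching of size $s$. *)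

(* Defs.v *)
From HB Require Import structures.
From mathcomp Require Import all_boot all_order all_algebra.
From mathcomp Require Import reals.

Set Implicit Arguments.
Unset Strict Implicit.
Unset Printing Implicit Defensive.

Import Order.TTheory GRing.Theory Num.Theory.

Local Open Scope ring_scope.

Record kgraph (k : nat) := KGraph {
  verts :> finType;
  edges : {set {set verts}};
  edges_uniform : forall e, e \in edges -> #|e| = k
}.

Definition neighbours (k : nat) (H : kgraph k) (S : {set H}) : {set {set H}} :=
  [set T : {set H} | (T \subset ~: S) && (T :|: S \in edges H)].

Definition degree (k : nat) (H : kgraph k) (S : {set H}) : nat :=
  #|neighbours S|.

(* Every degree is at most #|edges H|, so this default value does not affect
   the minimum as long as H has at least d vertices. *)
Definition min_degree (k : nat) (d : nat) (H : kgraph k) : nat :=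
  \big[minn/#|edges H|]_(S : {set H} | #|S| == d) degree S.

(* Only the values of f on edges matter. *)
Definition fractional_matching (R : realType) (k : nat) (H : kgraph k)
    (f : {set H} -> R) : Prop :=
  (forall e, e \in edges H -> 0 <= f e <= 1) /\
  (forall v : H, \sum_(e in edges H | v \in e) f e <= 1).

Definition matching_size (R : realType) (k : nat) (H : kgraph k)
    (f : {set H} -> R) : R :=
  \sum_(e in edges H) f e.

Definition forces_matching (R : realType) (d : nat) (s : rat) (k n : nat)
    (m : int) : Prop :=
  forall H : kgraph k, #|H| = n -> m <= (min_degree d H)%:Z ->
    exists f : {set H} -> R,
      fractional_matching f /\ matching_size f = ratr s.

(* The relation f_d^s(k,n) = m. *)
Definition is_threshold (R : realType) (d : nat) (s : rat) (k n : nat)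
    (m : int) : Prop :=
  forces_matching R d s k n m /\
  (forall m' : int, forces_matching R d s k n m' -> m <= m').

(* Main.v *)
(** Write t = ceil s - 1 and k' = k - d.  By linear programming duality a
    k-graph H without a fractional matching of size s has a fractional vertex
    cover w of total weight < s.  Let D be the d lightest vertices.  Subtracting
    the mean weight of D from all the weights and rescaling (Alon, Frankl,
    Huang, Rodl, Rucinski, Sudakov) yields weights of total < s outside D under
    which every edge of the link of D has weight >= 1, so it suffices to show
    that on W = V \ D at least C(|W| - t, k') of the k'-sets have weight < 1.

    Let U be W without its t + 1 heaviest vertices v_i, put a_i = 1 - w(v_i)
    and let c be the largest a_i; the weights on U are at most 1 - c, and
    w(U) < sum_i a_i.  Counting only the k'-sets with at most one vertex outside
    U, the claim becomes
      sum_i #{G in C(U, k' - 1) : w(G) >= a_i} + #{T in C(U, k') : w(T) >= 1}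
        <= t C(|U|, k' - 1).
    - If w(U) - c is small, then, as in Frankl's work on the Erdos matching
      conjecture, one averages over families of disjoint (k' - 1)-sets.  The
      sets T are handled by the shadow inequality, which is a double count when
      there is a fractional cover.
    - Otherwise c > 2/3, all the weights on U are below 1/3, and the claim
      follows from Markov-type inequalities for the second or third elementary
      symmetric function of the weights in a random set. *)
Require Import Defs.
From HB Require Import structures.
From mathcomp Require Import all_boot all_order all_algebra fingroup perm.
From mathcomp Require Import boolp reals.
From mathcomp Require Import ring lra zify.

Set Implicit Arguments.
Unset Strict Implicit.
Unset Printing Implicit Defensive.

Import Order.TTheory GRing.Theory Num.Theory.

Local Open Scope ring_scope.

(** * Farkas' lemma and the duality of fractional matchings and covers *)

(* Bartl's induction on the number of forms: if b fails at some x0 satisfying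
   the first n constraints, project along x0 onto the kernel of the last
   form. *)
Lemma farkas_nat (R : realFieldType) (I : finType) (n : nat)
    (a : nat -> I -> R) (b : I -> R) :
  (forall x : I -> R,
     (forall j, (j < n)%N -> \sum_i a j i * x i <= 0) ->
     \sum_i b i * x i <= 0) ->
  exists l : nat -> R, (forall j, 0 <= l j) /\
    forall i, b i = \sum_(j < n) l j * a j i.
Proof.
elim: n a b => [|n IHn] a b hb.
  exists (fun=> 0); split => // i; rewrite big_ord0; apply/eqP.
  have hle : \sum_i b i * b i <= 0 by apply: hb.
  have : \sum_i b i * b i == 0.
    by rewrite eq_le hle sumr_ge0 // => j _; rewrite -expr2 sqr_ge0.
  rewrite psumr_eq0 => [/allP/(_ i)|j _]; last by rewrite -expr2 sqr_ge0.
  by rewrite mem_index_enum mulf_eq0 orbb => /(_ isT).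
have [himp|] := pselect (forall x : I -> R,
     (forall j, (j < n)%N -> \sum_i a j i * x i <= 0) ->
     \sum_i b i * x i <= 0).
  have [l [l0 hl]] := IHn a b himp.
  exists (fun j => if (j < n)%N then l j else 0); split => [j|i].
    by case: ifP.
  rewrite big_ord_recr /= ltnn mul0r addr0 hl.
  by apply: eq_bigr => j _; rewrite ltn_ord.
move=> /existsNP[x0 /not_implyP[hx0 /negP]]; rewrite -ltNge => bx0.
have ax0 : 0 < \sum_i a n i * x0 i.
  rewrite ltNge; apply/negP => ax0; move: bx0; rewrite ltNge hb // => j.
  by rewrite ltnS leq_eqVlt => /predU1P[->|/hx0].
set u := \sum_i a n i * x0 i in ax0.
(* Subtracting [p f] times the last form makes [f] vanish at [x0]; by [pD] this amounts to
   projecting the argument along [x0]. *)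
pose p (f : I -> R) := (\sum_i f i * x0 i) / u.
have pD (f : I -> R) x : \sum_i (f i - p f * a n i) * x i =
    \sum_i f i * (x i - (\sum_i' a n i' * x i') / u * x0 i).
  rewrite (eq_bigr (fun i => f i * x i - p f * (a n i * x i))); last first.
    by move=> i _; ring.
  rewrite [RHS](eq_bigr (fun i => f i * x i
    - (\sum_i' a n i' * x i') / u * (f i * x0 i))); last by move=> i _; ring.
  by rewrite !sumrB -!mulr_sumr /p; ring.
have [x hx|l [l0 hl]] := IHn (fun j i => a j i - p (a j) * a n i)
  (fun i => b i - p b * a n i).
  rewrite pD; apply: hb => j; rewrite ltnS leq_eqVlt.
  case/predU1P => [->|/hx]; last by rewrite pD.
  have -> : \sum_i a n i * (x i - (\sum_i' a n i' * x i') / u * x0 i) =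
      \sum_i a n i * x i - (\sum_i' a n i' * x i') / u * u.
    rewrite {3}/u mulr_sumr -sumrB.
    by apply: eq_bigr => i _; ring.
  by rewrite divfK ?subrr // gt_eqF.
(* The last multiplier is nonnegative: [p b > 0], while [p (a j) <= 0] for the first [n] forms. *)
pose ln := p b - \sum_(j < n) l j * p (a j).
have ln0 : 0 <= ln.
  rewrite subr_ge0 (@le_trans _ _ 0) //; last by rewrite divr_ge0 // ltW.
  rewrite -oppr_ge0 -sumrN sumr_ge0 // => j _.
  rewrite -mulrN mulr_ge0 // /p -mulNr divr_ge0 ?(ltW ax0) // oppr_ge0.
  exact: hx0.
exists (fun j => if (j < n)%N then l j else ln); split => [j|i].
  by case: ifP.
rewrite big_ord_recr /= ltnn.
rewrite (eq_bigr (fun j : 'I_n => l j * a j i)); last first.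
  by move=> j _; rewrite ltn_ord.
have /eqP := hl i; rewrite subr_eq => /eqP ->.
rewrite (eq_bigr (fun j : 'I_n => l j * a j i - l j * p (a j) * a n i)).
  by rewrite sumrB -mulr_suml /ln; ring.
by move=> j _; ring.
Qed.

Lemma farkas (R : realFieldType) (I J : finType) (a : J -> I -> R)
    (b : I -> R) :
  (forall x : I -> R,
     (forall j, \sum_i a j i * x i <= 0) -> \sum_i b i * x i <= 0) ->
  exists l : J -> R, (forall j, 0 <= l j) /\
    forall i, b i = \sum_j l j * a j i.
Proof.
move=> hb; case: (pickP (@predT J)) => [j0 _|J0]; last first.
  have [|l [_ hl]] := @farkas_nat R I 0 (fun _ _ => 0) b.
    by move=> x _; apply: hb => j; have := J0 j.
  exists (fun=> 0); split => // i; rewrite hl big_ord0 big_pred0 //.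
have [|l [l0 hl]] := @farkas_nat R I (size (enum J))
  (fun j => a (nth j0 (enum J) j)) b.
  move=> x hx; apply: hb => j.
  by rewrite -(nth_index j0 (mem_enum J j)) hx // index_mem mem_enum.
exists (fun j => l (index j (enum J))); split => // i.
rewrite hl -[RHS]big_enum /= (big_nth j0) big_mkord; apply: eq_bigr => j _.
by rewrite index_uniq ?enum_uniq.
Qed.

(** Farkas' lemma is applied to vectors [(z, w)], with [None] the coordinate of a scale [z]. If no
    cover weighs less than [s], the constraints [0 <= w v] and [z <= w(e)] imply
    [s * z <= \sum_v w v]; the multipliers of the edge constraints form the matching, those of the
    vertex constraints its slack. *)
Lemma fractional_matching_or_cover (R : realFieldType) (V : finType)
    (E : {set {set V}}) (s : R) :
  0 < s -> set0 \notin E ->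
  (exists f : {set V} -> R,
    [/\ forall e, e \in E -> 0 <= f e <= 1,
        forall v, \sum_(e in E | v \in e) f e <= 1 &
        \sum_(e in E) f e = s]) \/
  (exists w : V -> R,
    [/\ forall v, 0 <= w v, forall e, e \in E -> 1 <= \sum_(v in e) w v &
        \sum_v w v < s]).
Proof.
move=> s0 E0.
have [hcov|ncov] := pselect (exists w : V -> R,
    [/\ forall v, 0 <= w v, forall e, e \in E -> 1 <= \sum_(v in e) w v &
        \sum_v w v < s]); [by right|left].
have sum_option (g : option V -> R) : \sum_i g i = g None + \sum_v g (Some v).
  rewrite (bigD1 None) //=; congr (_ + _).
  rewrite (reindex_omap Some id) => [|[]//]; apply: eq_bigl => v.
  by rewrite eqxx.
pose a (j : V + {set V}) (i : option V) : R :=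
  match j, i with
  | inl v, Some u => - (u == v)%:R
  | inl _, None => 0
  | inr e, Some u => - ((e \in E) && (u \in e))%:R
  | inr e, None => (e \in E)%:R
  end.
pose b (i : option V) : R := if i is Some _ then -1 else s.
have [x hx|l [l0 hl]] := @farkas R _ _ a b.
  rewrite sum_option /b /=; set z := x None.
  have w0 v : 0 <= x (Some v).
    have := hx (inl v); rewrite sum_option /= mul0r add0r.
    rewrite (bigD1 v) //= eqxx mulN1r big1 ?addr0 ?oppr_le0 // => u /negbTE ->.
    by rewrite oppr0 mul0r.
  have we e : e \in E -> z <= \sum_(v in e) x (Some v).
    move=> eE; have := hx (inr e); rewrite sum_option /= eE mul1r.
    rewrite -/z (eq_bigr (fun v => - (if v \in e then x (Some v) else 0))).
      by rewrite sumrN subr_le0 -big_mkcond.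
    by move=> v _ /=; case: (v \in e); rewrite ?mulN1r // oppr0 mul0r.
  rewrite (eq_bigr (fun v => - x (Some v))) => [|v _]; last by rewrite mulN1r.
  rewrite sumrN subr_le0; have [z0|z0] := leP z 0.
    by apply: le_trans (_ : 0 <= _); rewrite ?sumr_ge0 // pmulr_rle0.
  rewrite leNgt; apply/negP => hlt; apply: ncov.
  exists (fun v => x (Some v) / z); split => [v|e eE|].
  - by rewrite divr_ge0 // ltW.
  - by rewrite -mulr_suml ler_pdivlMr // mul1r we.
  - by rewrite -mulr_suml ltr_pdivrMr.
have suml (i : option V) : \sum_j l j * a j i =
    \sum_v l (inl v) * a (inl v) i + \sum_e l (inr e) * a (inr e) i.
  by rewrite big_sumType.
have fs : \sum_(e in E) l (inr e) = s.
  have := hl None; rewrite suml /b /= big1 => [->|v _]; last by rewrite mulr0.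
  rewrite add0r big_mkcond; apply: eq_bigr => e _.
  by case: (e \in E); rewrite ?mulr1 ?mulr0.
have fv v : \sum_(e in E | v \in e) l (inr e) <= 1.
  have := hl (Some v); rewrite suml /b /= (bigD1 v) //= eqxx mulrN1 => h.
  rewrite big1 in h => [|u /negbTE]; last first.
    by rewrite eq_sym => ->; rewrite oppr0 mulr0.
  have hS : \sum_e l (inr e) * - ((e \in E) && (v \in e))%:R =
      - \sum_(e in E | v \in e) l (inr e).
    rewrite [in RHS]big_mkcond -sumrN; apply: eq_bigr => e _.
    by case: (_ && _); rewrite ?mulrN1 // oppr0 mulr0.
  by have := l0 (inl v); move: h; rewrite hS; lra.
exists (fun e => l (inr e)); split => // e eE; rewrite l0 /=.
(* An edge has a vertex, and the load at this vertex bounds [f e]. *)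
have /set0Pn[v ve] : e != set0 by apply: contraNneq E0 => <-.
apply: le_trans (fv v); rewrite (bigD1 e) ?eE //= lerDl sumr_ge0 //.
Qed.

(** * Subsets of a fixed size, their weights and elementary symmetric functions *)

Definition ksets (V : finType) (U : {set V}) (k : nat) : {set {set V}} :=
  [set T : {set V} | (T \subset U) && (#|T| == k)].

Lemma in_ksets (V : finType) (U : {set V}) k T :
  (T \in ksets U k) = (T \subset U) && (#|T| == k).
Proof. by rewrite inE. Qed.

Lemma card_ksets (V : finType) (U : {set V}) k :
  #|ksets U k| = 'C(#|U|, k).
Proof. exact: cards_draws. Qed.

(** Deleting [v] from [T] matches the pairs [(T, v)] with the pairs [(G, v)]. This one double count
    serves [elsymS], [shadow_bound] and [heavy_lym]. *)
Lemma sum_flags (R : nmodType) (V : finType) (U : {set V}) k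
    (h : {set V} -> V -> R) :
  \sum_(T in ksets U k.+1) \sum_(v in T) h (T :\ v) v =
  \sum_(G in ksets U k) \sum_(v in U :\: G) h G v.
Proof.
rewrite (exchange_big_dep predT) //= [RHS](exchange_big_dep predT) //=.
apply: eq_bigr => v _.
rewrite (reindex_onto (fun G => v |: G) (fun T => T :\ v)) /=; last first.
  by move=> T /andP[_ vT]; rewrite setD1K.
apply: eq_big => [G|G /andP[_ /eqP ->]] //.
rewrite !inE eqxx /= andbT.
have [vG|vG] := boolP (v \in G).
  by rewrite /= andbF; apply/negP => /andP[_ /eqP/setP/(_ v)]; rewrite !inE eqxx vG.
by rewrite setU1K // eqxx andbT cardsU1 vG subUset sub1set add1n eqSS /= -andbA andbC.
Qed.

Definition wt (R : nmodType) (V : finType) (w : V -> R) (S : {set V}) : R :=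
  \sum_(v in S) w v.

Definition elsym (R : pzSemiRingType) (V : finType) (w : V -> R) j
    (S : {set V}) : R :=
  \sum_(J in ksets S j) \prod_(v in J) w v.

Definition heavy (R : realFieldType) (V : finType) (w : V -> R) (U : {set V})
    k (x : R) : R :=
  \sum_(G in ksets U k) (x <= wt w G)%R%:R.

Section Weights.
Variables (R : realFieldType) (V : finType) (w : V -> R).
Hypothesis w0 : forall v, 0 <= w v.

Lemma wt_ge0 (S : {set V}) : 0 <= wt w S.
Proof. by rewrite sumr_ge0. Qed.

Lemma wt_setD1 (S : {set V}) v : v \in S -> wt w S = w v + wt w (S :\ v).
Proof. by move=> vS; rewrite /wt (big_setD1 v). Qed.

Lemma wt_setD (S J : {set V}) : J \subset S ->
  wt w S = wt w J + wt w (S :\: J).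
Proof. by move=> JS; rewrite /wt (big_setID J) /= (setIidPr JS). Qed.

Lemma wt_le (S J : {set V}) : J \subset S -> wt w J <= wt w S.
Proof. by move=> /wt_setD ->; rewrite lerDl wt_ge0. Qed.

Lemma elsym_ge0 j (S : {set V}) : 0 <= elsym w j S.
Proof. by apply: sumr_ge0 => J _; apply: prodr_ge0. Qed.

(** Each monomial of degree [j + 1] arises from [j + 1] choices of the factor to split off. *)
Lemma elsymS j (S : {set V}) : j.+1%:R * elsym w j.+1 S =
  \sum_(J in ksets S j) (\prod_(v in J) w v) * wt w (S :\: J).
Proof.
transitivity (\sum_(T in ksets S j.+1) \sum_(v in T)
    (\prod_(u in T :\ v) w u) * w v).
  rewrite mulr_sumr; apply: eq_bigr => T; rewrite in_ksets => /andP[_ /eqP cT].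
  rewrite -cT mulr_natl -sumr_const; apply: eq_bigr => v vT.
  by rewrite (big_setD1 v vT) mulrC.
rewrite (sum_flags _ _ (fun (G : {set V}) v => (\prod_(u in G) w u) * w v)).
by apply: eq_bigr => J _; rewrite -mulr_sumr.
Qed.

Lemma elsymS_le j (S : {set V}) :
  j.+1%:R * elsym w j.+1 S <= wt w S * elsym w j S.
Proof.
rewrite elsymS mulr_sumr ler_sum // => J _; rewrite mulrC ler_wpM2r ?prodr_ge0 //.
by rewrite wt_le // subsetDl.
Qed.

(** Taking [J] out of [S] costs at most [j * dl] of the weight. *)
Lemma elsymS_ge j (S : {set V}) (dl : R) : (forall v, v \in S -> w v <= dl) ->
  (wt w S - j%:R * dl) * elsym w j S <= j.+1%:R * elsym w j.+1 S.
Proof.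
move=> wdl; rewrite elsymS mulr_sumr ler_sum // => J.
rewrite in_ksets => /andP[JS /eqP cJ]; rewrite mulrC ler_wpM2l ?prodr_ge0 //.
rewrite (wt_setD JS) lerBlDr addrC lerD2l -cJ mulr_natl -sumr_const.
by apply: ler_sum => v vJ; rewrite wdl // (subsetP JS).
Qed.

Lemma elsym1 (S : {set V}) : elsym w 1 S = wt w S.
Proof.
have := elsymS 0 S; rewrite mul1r => ->.
rewrite (_ : ksets S 0 = [set set0]) ?big_set1 ?big_set0 ?mul1r ?setD0 //.
by apply/setP => T; rewrite !inE cards_eq0 andbC; case: eqP => // ->; rewrite sub0set.
Qed.

Lemma card_ksets_super (U J : {set V}) k : J \subset U -> (#|J| <= k)%N ->
  #|[set T in ksets U k | J \subset T]| = 'C(#|U| - #|J|, k - #|J|).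
Proof.
move=> JU Jk; have -> : (#|U| - #|J|)%N = #|U :\: J|.
  by rewrite cardsD (setIidPr JU).
rewrite -card_ksets -(card_in_imset (f := fun T : {set V} => T :|: J)
    (D := mem (ksets (U :\: J) (k - #|J|)))); last first.
  move=> A B; rewrite !inE !subsetD => /andP[/andP[_ dA] _] /andP[/andP[_ dB] _] eAB.
  have {eAB} : (A :|: J) :\: J = (B :|: J) :\: J by rewrite eAB.
  rewrite !setDUl !setDv !setU0.
  by rewrite !(setDidPl _).
apply: eq_card => T; apply/idP/imsetP.
  rewrite !inE => /andP[/andP[TU /eqP cT] JT]; exists (T :\: J).
    by rewrite inE setSD //= cardsD (setIidPr JT) cT.
  by rewrite setUC setDE setUIr setUCr setIT (setUidPr JT).
move=> [A]; rewrite !inE subsetD => /andP[/andP[AU dA] /eqP cA] ->.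
rewrite subUset AU JU subsetUr andbT /= cardsU cA.
by rewrite (eqP (_ : A :&: J == set0)) ?setI_eq0 // cards0 subn0 subnK.
Qed.

(** Each [J] lies in the same number of sets [T]. This gives the mean of a symmetric function over a
    random [k]-set. *)
Lemma sum_elsym (U : {set V}) j k : (j <= k)%N ->
  \sum_(T in ksets U k) elsym w j T = elsym w j U * 'C(#|U| - j, k - j)%:R.
Proof.
move=> jk; rewrite (exchange_big_dep (mem (ksets U j))) /=; last first.
  by move=> T J; rewrite !inE => /andP[TU _] /andP[JT ->]; rewrite (subset_trans JT).
rewrite mulr_suml; apply: eq_bigr => J; rewrite in_ksets => /andP[JU /eqP cJ].
rewrite (eq_bigl (mem [set T in ksets U k | J \subset T])) => [|T].
  by rewrite sumr_const mulr_natr card_ksets_super ?cJ.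
by rewrite !inE cJ eqxx andbT.
Qed.

(* A heavy T satisfies 1 <= w(T), the sum of the w(v) over v in T, and each
   T :\ v has weight at least c. *)
Lemma shadow_bound (U : {set V}) k (c : R) :
  (forall v, v \in U -> w v <= 1 - c) ->
  heavy w U k.+1 1 <= (wt w U - c) * heavy w U k c.
Proof.
rewrite /heavy => wc.
apply: (@le_trans _ _ (\sum_(T in ksets U k.+1) \sum_(v in T)
    w v * (c <= wt w (T :\ v))%R%:R)).
  apply: ler_sum => T; rewrite in_ksets => /andP[TU _].
  have [T1|_] := leP 1 (wt w T); last first.
    by rewrite sumr_ge0 // => v _; rewrite mulr_ge0 // ler0n.
  apply: (le_trans T1); apply: ler_sum => v vT.
  rewrite (_ : c <= _) ?mulr1 //.
  have := wc v (subsetP TU v vT); move: T1; rewrite (wt_setD1 vT); lra.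
rewrite (sum_flags _ _ (fun (G : {set V}) v => w v * (c <= wt w G)%R%:R)) mulr_sumr.
apply: ler_sum => G; rewrite in_ksets => /andP[GU _].
rewrite -mulr_suml; have [cG|_] := leP c (wt w G); rewrite ?mulr0 // !mulr1.
by have := wt_setD GU; rewrite /wt => ->; rewrite addrAC lerDr subr_ge0.
Qed.

(* Local LYM inequality for the up-set of heavy sets. *)
Lemma heavy_lym (U : {set V}) k (x : R) :
  (#|U| - k)%:R * heavy w U k x <= k.+1%:R * heavy w U k.+1 x.
Proof.
rewrite /heavy.
have <- : \sum_(G in ksets U k) \sum_(v in U :\: G) (x <= wt w G)%R%:R =
    (#|U| - k)%:R * \sum_(G in ksets U k) (x <= wt w G)%R%:R :> R.
  rewrite mulr_sumr; apply: eq_bigr => G; rewrite in_ksets => /andP[GU /eqP cG].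
  by rewrite sumr_const cardsD (setIidPr GU) cG mulr_natl.
rewrite -(sum_flags _ _ (fun (G : {set V}) _ => (x <= wt w G)%R%:R)) mulr_sumr.
apply: ler_sum => T; rewrite in_ksets => /andP[_ /eqP cT].
rewrite -cT mulr_natl -sumr_const; apply: ler_sum => v vT.
rewrite ler_nat; have [xv|//] := leP x (wt w (T :\ v)).
by rewrite (le_trans xv) // wt_le // subsetDl.
Qed.

End Weights.

(** * Averaging over families of disjoint sets *)

Lemma exists_blocks (V : finType) (U : {set V}) l tau :
  (tau * l <= #|U|)%N ->
  exists B : nat -> {set V},
    (forall i, (i < tau)%N -> B i \in ksets U l) /\
    (forall i j, (i < tau)%N -> (j < tau)%N -> i != j -> [disjoint B i & B j]).
Proof.
elim: tau U => [|tau IHtau] U; first by exists (fun=> set0).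
rewrite mulSn => hU.
have [|B0] := set0Pn (ksets U l) _.
  by rewrite -card_gt0 card_ksets bin_gt0 (leq_trans _ hU) ?leq_addr.
rewrite in_ksets => /andP[B0U /eqP cB0].
have [|B [hB dB]] := IHtau (U :\: B0).
  by rewrite cardsD (setIidPr B0U) cB0 leq_subRL // (leq_trans _ hU) ?leq_addr.
have dB0 i : (i < tau)%N -> [disjoint B0 & B i].
  move=> /hB; rewrite in_ksets subsetD => /andP[/andP[_]].
  by rewrite disjoint_sym.
exists (fun i => if i is i'.+1 then B i' else B0); split=> [[_|i]|[|i] [|j]] //.
- by rewrite in_ksets B0U cB0 /=.
- by move=> /hB; rewrite !in_ksets subsetD -andbA => /and3P[-> _ ->].
- by move=> _ /dB0.
- by move=> /dB0; rewrite disjoint_sym.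
- by move=> hi hj; rewrite eqSS; apply: dB.
Qed.

Section Matchings.
Variables (R : realFieldType) (V : finType) (U : {set V}) (h : {set V} -> R).

Let orbsum (B : {set V}) : R :=
  \sum_(p : {perm V} | perm_on U p) h (p @: B).

Let orbsum_tperm x y (B : {set V}) : x \in U -> y \in U ->
  orbsum (tperm x y @: B) = orbsum B.
Proof.
move=> xU yU; rewrite /orbsum [RHS](reindex_inj (mulgI (tperm x y))) /=.
have hxy : perm_on U (tperm x y).
  by apply: (subset_trans (tperm_on x y)); rewrite subUset !sub1set xU.
apply: eq_big => [p|p _].
  apply/idP/idP => hp; first exact: perm_onM.
  by rewrite -[p](mulKg (tperm x y)) perm_onM // perm_onV.
congr h; rewrite -imset_comp; apply: eq_imset => z /=.
by rewrite permM.
Qed.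

(** Swapping an element of [B :\: B'] with one of [B' :\: B] shrinks the difference, so
    transpositions inside [U] lead from [B] to [B']. *)
Let orbsum_ksets l (B B' : {set V}) : B \in ksets U l -> B' \in ksets U l ->
  orbsum B = orbsum B'.
Proof.
have [n] := ubnP #|B :\: B'|; elim: n B => // n IHn B.
rewrite ltnS => cBB' hB hB'; move: (hB) (hB').
rewrite !in_ksets => /andP[BU /eqP cB] /andP[B'U /eqP cB'].
have [BB'|] := boolP (B \subset B').
  by congr orbsum; apply/eqP; rewrite eqEcard BB' cB cB' leqnn.
move=> /subsetPn[x xB xB'].
have /subsetPn[y yB' yB] : ~~ (B' \subset B).
  apply/negP => B'B; move: xB'; suff -> : B' = B by rewrite xB.
  by apply/eqP; rewrite eqEcard B'B cB cB' leqnn.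
have xU := subsetP BU x xB; have yU := subsetP B'U y yB'.
rewrite -(orbsum_tperm B xU yU); set C := tperm x y @: B.
have hC : C = y |: (B :\ x).
  apply/setP => z; rewrite -[z](tpermK x y) mem_imset; last exact: perm_inj.
  rewrite !inE tpermK; case: tpermP => [->|->|/eqP zx /eqP zy].
  - rewrite (negbTE yB) eqxx /= orbF; apply/esym/negbTE.
    by apply: contraNneq yB => <-.
  - by rewrite xB eqxx.
  - by rewrite (negbTE zx) (negbTE zy).
have hCU : C \in ksets U l.
  rewrite in_ksets card_imset ?cB ?eqxx ?andbT; last exact: perm_inj.
  by rewrite hC subUset sub1set yU (subset_trans (subD1set _ _)).
apply: IHn => //; apply: (leq_trans _ cBB'); apply: proper_card.
rewrite hC; apply/properP; split.
  apply/subsetP => z; rewrite !inE => /andP[zB' /orP[/eqP zy|/andP[_ ->]]].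
    by rewrite zy yB' in zB'.
  by rewrite zB'.
exists x; rewrite !inE ?xB ?xB' ?eqxx //= orbF.
by apply: contraNneq yB => <-.
Qed.

(* Averaging over all images of a fixed family of disjoint blocks under the
   permutations of U. *)
Lemma matching_average l tau (y : R) : (0 < tau)%N -> (tau * l <= #|U|)%N ->
  (forall B : 'I_tau -> {set V}, (forall j, B j \in ksets U l) ->
     (forall i j, i != j -> [disjoint B i & B j]) ->
     \sum_j h (B j) <= y * tau%:R) ->
  \sum_(G in ksets U l) h G <= y * 'C(#|U|, l)%:R.
Proof.
move=> tau0 /exists_blocks[B0 [hB0 dB0]] hy.
pose N : R := #|[pred p : {perm V} | perm_on U p]|%:R.
have N0 : 0 < N.
  by rewrite ltr0n; apply/card_gt0P; exists 1%g; rewrite inE perm_on1.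
have imU (p : {perm V}) (B : {set V}) : perm_on U p -> B \in ksets U l -> p @: B \in ksets U l.
  rewrite !in_ksets => pU /andP[BU cB]; rewrite card_imset ?cB ?andbT; last exact: perm_inj.
  by rewrite -(im_perm_on pU) imsetS.
have imK (f g : V -> V) (B : {set V}) : cancel f g -> g @: (f @: B) = B.
  by move=> fK; rewrite -imset_comp (eq_imset (g := id)) ?imset_id.
have hsum : \sum_(B in ksets U l) orbsum B = N * \sum_(B in ksets U l) h B.
  rewrite exchange_big /= mulr_natl -sumr_const; apply: eq_bigr => p pU.
  rewrite [RHS](reindex_onto (fun B : {set V} => p @: B)
    (fun B : {set V} => p^-1%g @: B)) /=.
    apply: eq_bigl => B; rewrite imK ?eqxx ?andbT; last exact: permK.
    apply/idP/idP => [|hB]; first exact: imU.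
    have -> : B = p^-1%g @: (p @: B) by rewrite imK //; apply: permK.
    by rewrite imU // perm_onV.
  by move=> B _; rewrite imK //; apply: permKV.
have hB i : (i < tau)%N -> orbsum (B0 i) = orbsum (B0 0%N).
  by move=> /hB0 hi; apply: orbsum_ksets hi (hB0 _ tau0).
have hC : \sum_(B in ksets U l) orbsum B = 'C(#|U|, l)%:R * orbsum (B0 0%N).
  rewrite -card_ksets mulr_natl -sumr_const; apply: eq_bigr => B HB.
  exact: orbsum_ksets HB (hB0 _ tau0).
(* A permutation of [U] carries the blocks to disjoint blocks, so [hy] applies to each of the [N]
   permutations. *)
have : tau%:R * orbsum (B0 0%N) <= N * (y * tau%:R).
  have -> : tau%:R * orbsum (B0 0%N) = \sum_(j < tau) orbsum (B0 j).
    rewrite (eq_bigr (fun=> orbsum (B0 0%N))) => [|j _]; last exact: hB.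
    by rewrite sumr_const card_ord mulr_natl.
  rewrite exchange_big /= mulr_natl -sumr_const; apply: ler_sum => p pU.
  apply: (hy (fun j => p @: B0 j)) => [j|i j ij].
    by apply: imU => //; apply: hB0.
  rewrite -setI_eq0 -imsetI => [|? ? _ _]; last exact: perm_inj.
  by rewrite imset_eq0 setI_eq0 dB0.
rewrite mulrA [leRHS]mulrC ler_pM2l ?ltr0n // => hle.
rewrite -(ler_pM2l N0) -hsum hC mulrA [leRHS]mulrC.
exact: ler_wpM2l.
Qed.

End Matchings.

(** Some entry reaches [a 0]; removing it lowers each count by at most one, which is made up for by
    shifting the index of [a]. *)
Lemma greedy_le_sum (R : realFieldType) (xs : seq R) (a : nat -> R) r :
  (forall x, x \in xs -> 0 <= x) ->
  (forall j, (j < r)%N -> (j < count (fun x => a j <= x)%R xs)%N) ->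
  \sum_(j < r) a j <= \sum_(x <- xs) x.
Proof.
elim: r xs a => [|r IHr] xs a xs0 ha.
  by rewrite big_ord0 big_seq sumr_ge0.
have /hasP[x xxs ax] : has (fun x => a 0%N <= x) xs by rewrite has_count ha.
rewrite big_ord_recl (perm_big _ (perm_to_rem xxs)) big_cons lerD //.
apply: (IHr _ (fun j => a j.+1)) => [y /mem_rem/xs0 //|j jr].
have := ha j.+1 jr; rewrite (seq.permP (perm_to_rem xxs)) /=.
by case: (_ <= _) => /=; [rewrite add1n ltnS | rewrite add0n => /ltnW].
Qed.

(* By greedy_le_sum, some a i is reached by at most i of the blocks. *)
Lemma blocks_rank_bound (R : realFieldType) tau t (X : 'I_tau -> R)
    (a : nat -> R) (D : R) :
  (forall j, 0 <= X j) -> (forall i j, (i <= j)%N -> a j <= a i) ->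
  \sum_j X j < \sum_(i < t.+1) a i -> (t < tau)%N -> D <= (tau - t.+1)%:R ->
  \sum_j (\sum_(i < t.+1) (a i <= X j)%R%:R + D * (a 0%N <= X j)%R%:R)
    <= t%:R * tau%:R.
Proof.
move=> X0 a_anti hX ttau hD.
pose g i := #|[pred j | a i <= X j]|.
have gE i : \sum_j (a i <= X j)%R%:R = (g i)%:R :> R.
  rewrite /g -sumr_const [in RHS]big_mkcond /=.
  by apply: eq_bigr => j _; rewrite inE; case: (a i <= X j).
have [i0 it hi0] : exists2 i, (i <= t)%N & (g i <= i)%N.
  apply: contrapT => hno; move: hX; apply/negP; rewrite -leNgt.
  have -> : \sum_j X j = \sum_(x <- [seq X j | j <- enum 'I_tau]) x.
    by rewrite big_map big_enum.
  apply: greedy_le_sum => [_ /mapP[j _ ->] //|j]; rewrite ltnS => jt.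
  rewrite (_ : count _ _ = g j).
    by rewrite ltnNge; apply/negP => hle; apply: hno; exists j.
  by rewrite count_map enumT /g cardE /enum_mem size_filter; apply: eq_count.
have g_mono i j : (i <= j)%N -> (g i <= g j)%N.
  move=> ij; apply: subset_leq_card; apply/subsetP => x; rewrite !inE.
  exact: le_trans (a_anti _ _ ij).
have g_tau i : (g i <= tau)%N by rewrite -[leqRHS]card_ord max_card.
rewrite big_split /= exchange_big /= -mulr_sumr gE.
rewrite (eq_bigr (fun i : 'I_t.+1 => (g i)%:R)) => [|i _]; last exact: gE.
(* By monotonicity [g i <= i0] for [i <= i0]; the other [t - i0] terms are at most [tau]. *)
have hS : (\sum_(i < t.+1) g i <= i0.+1 * i0 + (t - i0) * tau)%N.
  rewrite -(big_mkord xpredT g) (@big_cat_nat _ _ _ i0.+1) //=.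
  apply: leq_add.
    rewrite -[X in (X * _)%N]subn0 -sum_nat_const_nat big_nat [leqRHS]big_nat.
    apply: leq_sum => i /andP[_]; rewrite ltnS => ii0.
    exact: leq_trans (g_mono _ _ ii0) hi0.
  rewrite -subSS -sum_nat_const_nat; apply: leq_sum => i _; exact: g_tau.
have hD' : D * (g 0%N)%:R <= (tau - t.+1)%:R * i0%:R.
  apply: (le_trans (ler_wpM2r (ler0n _ _) hD)).
  by rewrite ler_wpM2l ?ler0n // ler_nat (leq_trans (g_mono _ i0 _)).
rewrite -(ler_nat R) natr_sum in hS; apply: (le_trans (lerD hS hD')).
rewrite -!natrM -natrD ler_nat.
(* The bounds add up to [t * tau - i0 * (t - i0)]. *)
have [e ->] : exists e, tau = (t.+1 + e)%N by exists (tau - t.+1)%N; lia.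
have [f ->] : exists f, t = (i0 + f)%N by exists (t - i0)%N; lia.
nia.
Qed.

(** The shadow bound turns the heavy sets of size [l.+1] into sets of size [l] reaching [a 0], with
    coefficient [wt w U - a 0]. Then [blocks_rank_bound] applies to every family of [tau] disjoint
    blocks, whose total weight is at most [wt w U]. *)
Lemma heavy_bound_matching (R : realFieldType) (V : finType) (w : V -> R)
    (U : {set V}) (a : nat -> R) t l tau :
  (forall v, 0 <= w v) -> (forall i j, (i <= j)%N -> a j <= a i) ->
  (forall v, v \in U -> w v <= 1 - a 0%N) ->
  wt w U < \sum_(i < t.+1) a i -> (t < tau)%N -> (tau * l <= #|U|)%N ->
  wt w U - a 0%N <= (tau - t.+1)%:R ->
  \sum_(i < t.+1) heavy w U l (a i) + heavy w U l.+1 1 <= t%:R * 'C(#|U|, l)%:R.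
Proof.
move=> w0 a_anti wa hU ttau hl hD.
apply: (le_trans (lerD (lexx _) (shadow_bound w0 l wa))).
rewrite /heavy exchange_big /= mulr_sumr -big_split /=.
apply: (@matching_average R V U (fun G =>
  \sum_(i < t.+1) (a i <= wt w G)%R%:R +
  (wt w U - a 0%N) * (a 0%N <= wt w G)%R%:R) l tau); rewrite ?(leq_trans _ ttau) //.
move=> B hB dB; apply: blocks_rank_bound => //.
  by move=> j; apply: wt_ge0.
apply: le_lt_trans hU; rewrite /wt.
rewrite -partition_disjoint_bigcup //.
apply: (wt_le w0); apply/bigcupsP => j _.
by have := hB j; rewrite in_ksets => /andP[].
Qed.

(** * Pointwise bounds on the number of thresholds that a weight reaches *)

Section Rank.
Variables (R : realFieldType) (t : nat) (a : nat -> R) (A : R).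
Let c := a 0%N.
Let r : R := t.+1%:R.
Hypothesis a_anti : forall i j, (i <= j)%N -> a j <= a i.
Hypothesis A0 : 0 < A.
Hypothesis Ac : A <= c.
Hypothesis hA : r * A <= \sum_(i < t.+1) a i.

Let rank (X : R) : R := \sum_(i < t.+1) (a i <= X)%R%:R.

Lemma rank_le X : rank X <= r.
Proof.
rewrite /rank /r -[t.+1 in leRHS]card_ord -sumr_const ler_sum // => i _.
by rewrite lern1 leq_b1.
Qed.

(** Each threshold counted lies at least [c - X] below [c], and all these gaps together sum to at
    most [r * (c - A)]. *)
Lemma rank_gap X : rank X * (c - X) <= r * (c - A).
Proof.
apply: (@le_trans _ _ (\sum_(i < t.+1) (c - a i))).
  rewrite mulr_suml ler_sum // => i _.
  have := a_anti (leq0n i); rewrite -/c.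
  by have [|] := leP (a i) X; rewrite ?mul1r ?mul0r; lra.
by rewrite sumrB sumr_const card_ord -mulr_natl -/r mulrBr lerD2l lerN2.
Qed.

(** The right-hand side is the chord, between [X = 0] and [X = A], of the convex bound
    [r * (c - A) / (c - X)] given by [rank_gap]. It reaches the trivial bound [r] at [X = A]. *)
Lemma rank_markov X : 0 <= X -> rank X <= r * (1 - A / c) + r / c * X.
Proof.
move=> X0; have c0 : 0 < c by apply: lt_le_trans Ac.
have r0 : 0 < r by rewrite ltr0n.
rewrite -(ler_pM2r c0).
have -> : (r * (1 - A / c) + r / c * X) * c = r * (c - A + X).
  by field; rewrite gt_eqF.
have hr := rank_le X; have hg := rank_gap X.
have [AX|XA] := leP A X.
  apply: (le_trans (ler_wpM2r (ltW c0) hr)); rewrite ler_pM2l //; lra.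
have cX : 0 < c - X by have := Ac; lra.
rewrite -(ler_pM2r cX); apply: (@le_trans _ _ (c * (r * (c - A)))).
  by rewrite mulrAC mulrC ler_pM2l.
rewrite -mulrA mulrCA ler_pM2l //; nra.
Qed.

(* The right-hand side dominates at the critical values 1 - c, A and 1 of X;
   in between, both sides are compared by convexity. *)
Lemma rank_quadratic X (e lam al be : R) :
  2^-1 < c -> c <= 1 -> 1 - c <= A ->
  al = (c - A) / (c * (2 * c - 1)) ->
  0 <= lam -> (c * (2 * c - 1))^-1 <= be -> (lam + A / c) / c <= be ->
  0 <= X -> 0 <= e -> (X - (1 - c)) * X <= e ->
  rank X + r * lam * (1 <= X)%R%:R <= r * (1 - A / c + al * X + be * e).
Proof.
move=> c2 c1 cA alE lam0 be1 be2 X0 e0 eX; have hAc := Ac.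
have r0 : 0 < r by rewrite ltr0n.
have c0 : 0 < c by lra.
have y0 : 0 < 2 * c - 1 by lra.
have cy0 : 0 < c * (2 * c - 1) by rewrite mulr_gt0.
have al0 : 0 <= al by rewrite alE divr_ge0 ?(ltW cy0) // subr_ge0.
have beta0 : 0 <= be by apply: le_trans be1; rewrite invr_ge0 ltW.
have alE' : al * (c * (2 * c - 1)) = c - A by rewrite alE divfK // gt_eqF.
have be1' : 1 <= be * (c * (2 * c - 1)) by rewrite -ler_pdivrMr // mul1r.
have be2' : lam + A / c <= be * c by rewrite -ler_pdivrMr.
have AcE : A / c * c = A by rewrite divfK // gt_eqF.
have hr := rank_le X; have hg := rank_gap X.
set p := A / c in be2' AcE *.
(* For [X >= 1] one has [e >= c], and the second lower bound on [be] lets [be * e] cover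
   [lam + A / c]. *)
have [X1|X1] := leP 1 X.
  rewrite mulr1; apply: (@le_trans _ _ (r * (1 + lam))); first by lra.
  rewrite ler_pM2l //.
  have : c <= e by apply: le_trans eX; nra.
  by nra.
rewrite mulr0 addr0.
(* The choice of [al] makes the right-hand side equal to [r] at [X = A], [e = A * (A - (1 - c))]
   when [be] is [(c * (2 * c - 1))^-1]. *)
have [AX|XA] := leP A X.
  apply: (le_trans hr); rewrite -[leLHS]mulr1 ler_pM2l //.
  have e1 : A * (A - (1 - c)) <= e by apply: le_trans eX; nra.
  have : p <= al * A + be * (A * (A - (1 - c))).
    rewrite -(ler_pM2r cy0).
    have -> : p * (c * (2 * c - 1)) = A * (2 * c - 1) by rewrite mulrA AcE.
    have -> : (al * A + be * (A * (A - (1 - c)))) * (c * (2 * c - 1)) =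
        (c - A) * A + be * (c * (2 * c - 1)) * (A * (A - (1 - c))).
      by rewrite -alE'; ring.
    have : A * (A - (1 - c)) <= be * (c * (2 * c - 1)) * (A * (A - (1 - c))).
      by rewrite ler_peMl // mulr_ge0 ?subr_ge0 // ltW.
    by nra.
  by nra.
have cX : 0 < c - X by have := Ac; lra.
rewrite -(ler_pM2r cX); apply: (le_trans hg); rewrite -mulrA ler_pM2l //.
rewrite -(ler_pM2r cy0).
have -> : (1 - p + al * X + be * e) * (c - X) * (c * (2 * c - 1)) =
  ((c - A) * (2 * c - 1) + (c - A) * X + be * (c * (2 * c - 1)) * e) * (c - X).
  transitivity (((c - p * c) * (2 * c - 1) + al * (c * (2 * c - 1)) * X
    + be * (c * (2 * c - 1)) * e) * (c - X)); first by ring.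
  by rewrite AcE alE'.
have he : Num.max 0 ((X - (1 - c)) * X) <= be * (c * (2 * c - 1)) * e.
  rewrite ge_max mulr_ge0 // ?mulr_ge0 // ?(ltW c0) ?(ltW y0) //=.
  by apply: (le_trans eX); rewrite ler_peMl.
(* With denominators cleared, the surplus is at least [(c - A) * X * (1 - c - X)] in the first range
   and [X * (X - (1 - c)) * (A - X)] in the second. *)
have [Xd|Xd] := leP X (1 - c).
  have e1 : 0 <= be * (c * (2 * c - 1)) * e by apply: le_trans he; rewrite le_max lexx.
  apply: (@le_trans _ _ (((c - A) * (2 * c - 1) + (c - A) * X) * (c - X))).
    have : 0 <= (c - A) * X * (1 - c - X) by rewrite !mulr_ge0 // subr_ge0.
    by lra.
  by rewrite ler_pM2r //; lra.
have e1 : (X - (1 - c)) * X <= be * (c * (2 * c - 1)) * e.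
  by apply: le_trans he; rewrite le_max lexx orbT.
apply: (@le_trans _ _ (((c - A) * (2 * c - 1) + (c - A) * X + (X - (1 - c)) * X) * (c - X))).
  have : 0 <= X * (X - (1 - c)) * (A - X) by rewrite !mulr_ge0 // subr_ge0 ltW.
  by lra.
by rewrite ler_pM2r //; lra.
Qed.

End Rank.

(** * Binomial estimates and numerical inequalities *)

Lemma bin_pred1 m l : (m * 'C(m - 1, l) = l.+1 * 'C(m, l.+1))%N.
Proof. by rewrite subn1 mul_bin_diag. Qed.

Lemma bin_pred2 m l :
  (m * (m - 1) * 'C(m - 2, l) = l.+2 * l.+1 * 'C(m, l.+2))%N.
Proof.
have := bin_pred1 (m - 1) l; rewrite -subnDA => h.
by rewrite -mulnA h mulnCA (bin_pred1 m l.+1); lia.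
Qed.

Lemma bin_succ m l : (l.+1 * 'C(m, l.+1) = (m - l) * 'C(m, l))%N.
Proof. by rewrite mul_bin_left. Qed.

(** Passing from ['C(m - 2, l)] to ['C(m - 3, l)] gains the factor [(m - 2 - l) / (m - 2)]. As
    [l >= 1], it is at most [(m - 1) / m], which improves [m * (m - 1)] to [m * m]. *)
Lemma bin_pred3 m l : (1 <= l)%N -> (3 <= m)%N ->
  (m * m * 'C(m - 3, l) <= l.+2 * l.+1 * 'C(m, l.+2))%N.
Proof.
move=> l1 m3; rewrite -bin_pred2 -!mulnA leq_pmul2l; last by lia.
have h : ((m - 2) * 'C(m - 3, l) = (m - 2 - l) * 'C(m - 2, l))%N.
  by have := mul_bin_down (m - 2) l; rewrite -subnS.
have [hl|hl] := leqP l (m - 2); last by rewrite bin_small ?muln0 //; lia.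
rewrite -(@leq_pmul2l (m - 2)); last by lia.
rewrite mulnCA h mulnCA mulnA mulnA leq_mul2r; apply/orP; right.
have [e ->] : exists e, m = (l + 2 + e)%N by exists (m - 2 - l)%N; lia.
nia.
Qed.

(** Used with [r = t + 1], [v = 1 / r], [L = l], [z = l * r / m] and [q = (l - 1) / l], where [m] is
    the size of [U]. *)
Lemma large_cut_numerics (R : realFieldType) (A c z q v L : R) :
  2 / 3 <= A -> A <= c -> 7 / 9 <= c -> c <= 1 -> 0 <= z -> z <= 3 / 5 ->
  3 <= L -> q * L = L - 1 -> 0 <= v -> v * (L + 1) <= 9 / 25 ->
  v * c <= A * (1 - z - A ^+ 2 * z ^+ 2 * q / (2 * c - 1)).
Proof.
move=> hA Ac c7 c1 z0 z3 L3 hq v0 hv.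
have y0 : 0 < 2 * c - 1 by lra.
pose E := c - A; have E0 : 0 <= E by rewrite /E; lra.
have E3 : E <= 1 / 3 by rewrite /E; lra.
pose p := 1 - q; have pL : p * L = 1 by rewrite /p mulrBl hq; ring.
have p0 : 0 < p by have := ltr01 (R := R); rewrite -pL; move=> ?; nra.
have p3 : p <= 1 / 3 by nra.
have q0 : 0 <= q by rewrite /p in p3; lra.
(* The constant [49 / 45] is the value of the left-hand side at [A = c = 7 / 9]. *)
have hy : A ^+ 2 / (2 * c - 1) <= 49 / 45 - 4 / 3 * E.
  rewrite ler_pdivrMr // /E.
  have : 0 <= (9 * c - 7) * (7 - 5 * c) by rewrite mulr_ge0 //; lra.
  have : 0 <= (c - A) * (1 - c) by rewrite mulr_ge0 //; lra.
  have : 0 <= (c - A) * (c + A - 4 / 3) by rewrite mulr_ge0 //; lra.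
  by lra.
have y2 : 0 <= A ^+ 2 / (2 * c - 1) by rewrite divr_ge0 ?sqr_ge0 // ltW.
have hz : A ^+ 2 * z ^+ 2 * q / (2 * c - 1) <= 9 / 25 * (q * (49 / 45 - 4 / 3 * E)).
  have -> : A ^+ 2 * z ^+ 2 * q / (2 * c - 1) =
      z ^+ 2 * (q * (A ^+ 2 / (2 * c - 1))) by ring.
  have hz2 : z ^+ 2 <= 9 / 25 by nra.
  exact: ler_pM (sqr_ge0 _) (mulr_ge0 q0 y2) hz2 (ler_wpM2l q0 hy).
have hcA : c <= A * (1 + 3 / 2 * E) by rewrite /E; nra.
have hvp : v <= 9 / 25 * p by nra.
have hv2 : v * c <= 9 / 25 * p * (A * (1 + 3 / 2 * E)).
  by apply: ler_pM => //; lra.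
apply: (le_trans hv2).
have -> : 9 / 25 * p * (A * (1 + 3 / 2 * E)) = A * (9 / 25 * p * (1 + 3 / 2 * E)).
  by ring.
rewrite ler_pM2l; last by lra.
have : 0 <= E * (1 / 3 - p) by rewrite mulr_ge0 // subr_ge0.
have : q = 1 - p by rewrite /p; ring.
move=> qE; rewrite qE in hz; nra.
Qed.

(** Here [v] and [z] are as in [large_cut_numerics], [z'] is [z] with [l + 1] for [l], and
    [y = m / (m - 1)]. The two members of the maximum [be] are treated separately. *)
Lemma small_cut_numerics (R : realFieldType) (A c z z' y v lam al be : R) :
  2 / 3 <= A -> A <= c -> c <= 7 / 9 -> 0 <= z -> z <= 3 / 5 ->
  0 <= z' -> z' <= 7 / 10 -> 0 <= y -> y <= 101 / 100 -> v <= 9 / 175 ->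
  0 <= lam -> lam * z' <= 1 ->
  al = (c - A) / (c * (2 * c - 1)) ->
  be = Num.max (c * (2 * c - 1))^-1 ((lam + A / c) / c) ->
  v <= A / c - al * (A * z') - be * (A ^+ 2 * (z' * z * y)).
Proof.
move=> hA Ac c7 z0 z3 z'0 z'7 y0 y1 hv lam0 hlam alE beE.
have c0 : 0 < c by lra.
have d0 : 0 < 2 * c - 1 by lra.
have A0 : 0 < A by lra.
have Ac0 : 0 <= A / c by rewrite divr_ge0 // ltW.
have cA0 : 0 <= (c - A) / (2 * c - 1) by rewrite divr_ge0 ?(ltW d0) ?subr_ge0.
have cd0 : 0 < c * (2 * c - 1) by rewrite mulr_gt0.
have hal : al * (A * z') <= A / c * (7 / 10 * ((c - A) / (2 * c - 1))).
  have -> : al * (A * z') = (A / c * ((c - A) / (2 * c - 1))) * z'.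
    by rewrite alE; field; rewrite !gt_eqF.
  have -> : A / c * (7 / 10 * ((c - A) / (2 * c - 1))) =
      (A / c * ((c - A) / (2 * c - 1))) * (7 / 10) by ring.
  by apply: ler_wpM2l => //; apply: mulr_ge0.
have hz'z : z' * z <= 21 / 50.
  by apply: le_trans (ler_pM z'0 z0 z'7 z3) _; clear; lra.
have hzy : z' * z * y <= 4242 / 10000.
  by apply: le_trans (ler_pM (mulr_ge0 z'0 z0) y0 hz'z y1) _; clear; lra.
have hbe : be * (A ^+ 2 * (z' * z * y)) <=
    A / c * (47 / 50 - 7 / 10 * ((c - A) / (2 * c - 1))).
  have e0 : 0 <= A ^+ 2 * (z' * z * y) by rewrite mulr_ge0 ?sqr_ge0 // !mulr_ge0.
  rewrite beE (maxr_pMl _ _ e0).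
  rewrite ge_max; apply/andP; split.
    have -> : (c * (2 * c - 1))^-1 * (A ^+ 2 * (z' * z * y)) =
       A / c * ((A * (z' * z * y)) / (2 * c - 1)) by field; rewrite !gt_eqF.
    apply: ler_wpM2l => //; rewrite lerBrDr.
    have -> : A * (z' * z * y) / (2 * c - 1) + 7 / 10 * ((c - A) / (2 * c - 1)) =
      (A * (z' * z * y) + 7 / 10 * (c - A)) / (2 * c - 1) by ring.
    rewrite ler_pdivrMr //; move: (ler_wpM2l (ltW A0) hzy) hA Ac; clear; lra.
  have -> : (lam + A / c) / c * (A ^+ 2 * (z' * z * y)) =
     A / c * (A * (z * y * (lam * z') + z' * z * y * (A / c))).
    by field; rewrite !gt_eqF.
  apply: ler_wpM2l => //.
  have hAc : A / c <= 1 by rewrite ler_pdivrMr // mul1r.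
  have h1 : z * y * (lam * z') <= 606 / 1000.
    apply: le_trans (ler_piMr _ hlam) _; first exact: mulr_ge0.
    by apply: le_trans (ler_pM z0 y0 z3 y1) _; clear; lra.
  have h2 : z' * z * y * (A / c) <= 4242 / 10000.
    by apply: le_trans (ler_piMr _ hAc) hzy; rewrite !mulr_ge0.
  have h3 : (c - A) / (2 * c - 1) <= 3 * (c - A).
    rewrite ler_pdivrMr // mulrAC ler_peMl ?subr_ge0 //.
    by move: hA Ac; clear; lra.
  have h4 := ler_wpM2l (ltW A0) (lerD h1 h2).
  by move: h4 h3 hA Ac c7; clear; lra.
have hAc : 6 / 7 <= A / c by rewrite ler_pdivlMr //; move: hA c7; clear; lra.
move: hAc hal hbe hv; clear; lra.
Qed.

(** * Markov-type bounds when the weight on [U] is large *)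

Section Spread.
Variables (R : realFieldType) (V : finType) (w : V -> R) (U : {set V}).
Variables (a : nat -> R) (t l : nat).
Let c := a 0%N.
Let r : R := t.+1%:R.
Let m := #|U|.
Let A : R := wt w U / r.
Let M : R := 'C(m, l)%:R.
Hypothesis w0 : forall v, 0 <= w v.
Hypothesis a_anti : forall i j, (i <= j)%N -> a j <= a i.
Hypothesis wc : forall v, v \in U -> w v <= 1 - c.
Hypothesis c1 : c <= 1.
Hypothesis hU : wt w U < \sum_(i < t.+1) a i.
Hypothesis hA : 2 / 3 <= A.
Hypothesis l3 : (3 <= l)%N.
Hypothesis hm : (5 * (t.+1 * l) <= 3 * m)%N.
Hypothesis ht : (25 * l.+1 <= 9 * t.+1)%N.

Let r0 : 0 < r. Proof. by rewrite ltr0n. Qed.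
Let rA : r * A = wt w U. Proof. by rewrite mulrC divfK // gt_eqF. Qed.
Let A0 : 0 < A. Proof. by apply: lt_le_trans hA; lra. Qed.
Let Ac : A <= c.
Proof.
rewrite ler_pdivrMr // mulrC; apply: (le_trans (ltW hU)).
rewrite /r -[t.+1 in leRHS]card_ord mulr_natl -sumr_const ler_sum // => i _.
exact: a_anti.
Qed.
Let hrA : r * A <= \sum_(i < t.+1) a i. Proof. by rewrite rA ltW. Qed.
Let lm : (l < m)%N. Proof. by move: hm l3 ht; nia. Qed.
Let m0 : 0 < m%:R :> R. Proof. by rewrite ltr0n (leq_ltn_trans _ lm). Qed.
Let M0 : 0 < M. Proof. by rewrite ltr0n bin_gt0 ltnW. Qed.

Let sum_rank k : \sum_(i < t.+1) heavy w U k (a i) =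
  \sum_(G in ksets U k) \sum_(i < t.+1) (a i <= wt w G)%R%:R.
Proof. by rewrite /heavy exchange_big. Qed.

Let sum_wt k : (0 < k)%N ->
  \sum_(G in ksets U k) wt w G = r * A * (k%:R * 'C(m, k)%:R / m%:R).
Proof.
move=> k0; rewrite (eq_bigr (elsym w 1)) => [|G _]; last by rewrite elsym1.
rewrite sum_elsym // elsym1 rA; congr (_ * _).
have := congr1 (fun n => n%:R : R) (bin_pred1 m (k - 1)).
rewrite !natrM (_ : (k - 1).+1 = k) => [h|]; last by rewrite subn1 prednK.
by apply: (mulfI (lt0r_neq0 m0)); rewrite h; field; exact: lt0r_neq0.
Qed.

Let elsym2_le : 2 * elsym w 2 U <= (r * A) ^+ 2.
Proof. by have := elsymS_le w0 1 U; rewrite elsym1 rA expr2. Qed.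

Let elsym3_le : 6 * elsym w 3 U <= (r * A) ^+ 3.
Proof.
have h := elsymS_le w0 2 U; rewrite -rA in h.
have rA0 : 0 <= r * A by rewrite mulr_ge0 // ltW.
have := ler_wpM2l rA0 elsym2_le; rewrite -exprS; move: h; lra.
Qed.

Let elsym2_ge (T : {set V}) : T \subset U ->
  (wt w T - (1 - c)) * wt w T <= 2 * elsym w 2 T.
Proof.
move=> TU; have := @elsymS_ge _ _ _ w0 1 T (1 - c) _; rewrite elsym1 mul1r.
by apply=> v vT; apply: wc (subsetP TU v vT).
Qed.

(** The sets of size [l] are handled by averaging [rank_markov]. A set [T] of weight at least 1
    whose weights are at most [1 - c] satisfies [2 * elsym w 2 T >= c] and
    [6 * elsym w 3 T >= c * (2 * c - 1)], so Markov's inequality for the third symmetric function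
    bounds the number of such [T]. *)
Lemma heavy_bound_spread_large_cut : 7 / 9 <= c ->
  \sum_(i < t.+1) heavy w U l (a i) + heavy w U l.+1 1 <= t%:R * M.
Proof.
move=> c7.
have y0 : 0 < 2 * c - 1 by move: c7; lra.
have c0 : 0 < c by move: c7; lra.
have h1 : \sum_(i < t.+1) heavy w U l (a i) <=
    r * (1 - A / c) * M + r / c * (r * A * (l%:R * M / m%:R)).
  rewrite sum_rank.
  apply: (@le_trans _ _ (\sum_(G in ksets U l)
     (r * (1 - A / c) + r / c * wt w G))).
    by apply: ler_sum => G _; apply: rank_markov => //; apply: wt_ge0.
  rewrite big_split /= sumr_const card_ksets -mulr_sumr -[_ *+ _ in leLHS]mulr_natr.
  by rewrite sum_wt ?(leq_trans _ l3).
have h2 : heavy w U l.+1 1 * (c * (2 * c - 1)) <=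
    (r * A) ^+ 3 * 'C(m - 3, l - 2)%:R.
  apply: (@le_trans _ _ (6 * elsym w 3 U * 'C(m - 3, l - 2)%:R)); last first.
    by rewrite ler_wpM2r.
  rewrite -[6 * _ * _]mulrA -[(l - 2)%N]/(l.+1 - 3)%N -sum_elsym ?(leq_trans l3) //.
  rewrite /heavy mulr_suml mulr_sumr; apply: ler_sum => T.
  rewrite in_ksets => /andP[TU _].
  have [T1|_] := leP 1 (wt w T); last by rewrite mul0r mulr_ge0 ?elsym_ge0.
  have e2 := elsym2_ge TU.
  have e3 := @elsymS_ge _ _ _ w0 2 T (1 - c) (fun v vT => wc (subsetP TU v vT)).
  have p2 : c <= 2 * elsym w 2 T.
    apply: le_trans e2; move: T1 c1 c0; nra.
  rewrite mul1r; apply: (@le_trans _ _ (2 * ((wt w T - 2 * (1 - c)) * elsym w 2 T))).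
    by move: T1 p2 y0 c0; nra.
  by move: e3; lra.
have h3 : 'C(m - 3, l - 2)%:R <= l%:R * (l%:R - 1) * M / (m%:R * m%:R).
  rewrite ler_pdivlMr ?mulr_gt0 // mulrC -natrM.
  have -> : l%:R - 1 = (l - 1)%:R :> R by rewrite natrB // (leq_trans _ l3).
  have l1 : (1 <= l - 2)%N by rewrite subn_gt0.
  have m3 : (3 <= m)%N by rewrite (leq_trans l3) // ltnW.
  have e2 : (l - 2).+2 = l by rewrite -addn2 subnK // ltnW.
  have e1 : (l - 2).+1 = (l - 1)%N by rewrite -{2}e2 subn1.
  by have := bin_pred3 l1 m3; rewrite -(ler_nat R) !natrM e2 e1.
pose z : R := l%:R * r / m%:R; pose q : R := (l%:R - 1) / l%:R.
have l0 : 0 < l%:R :> R by rewrite ltr0n (leq_trans _ l3).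
have z0 : 0 <= z by rewrite !mulr_ge0 // ?invr_ge0 ltW.
have z3 : z <= 3 / 5.
  rewrite ler_pdivrMr // mulrC.
  by move: hm; rewrite -(ler_nat R) !natrM -/r; lra.
have L3 : 3 <= l%:R :> R by rewrite ler_nat.
have hq : q * l%:R = l%:R - 1 by rewrite divfK // lt0r_neq0.
have v0 : 0 <= r^-1 by rewrite invr_ge0 ltW.
have hv : r^-1 * (l%:R + 1) <= 9 / 25.
  rewrite mulrC ler_pdivrMr //.
  by move: ht; rewrite -(ler_nat R) !natrM -/r -[l.+1%:R]natr1; lra.
have hnum := large_cut_numerics hA Ac c7 c1 z0 z3 L3 hq v0 hv.
rewrite -(ler_pdivlMr _ _ (mulr_gt0 c0 y0)) in h2.
apply: (le_trans (lerD h1 (le_trans h2 _))).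
  apply: ler_wpM2r; first by rewrite invr_ge0 ltW // mulr_gt0.
  by apply: ler_wpM2l h3; rewrite exprn_ge0 // mulr_ge0 // ltW.
have -> : r * (1 - A / c) * M + r / c * (r * A * (l%:R * M / m%:R)) +
    (r * A) ^+ 3 * (l%:R * (l%:R - 1) * M / (m%:R * m%:R)) / (c * (2 * c - 1)) =
    M * (r - r / c * (A * (1 - z - A ^+ 2 * z ^+ 2 * q / (2 * c - 1)))).
  by rewrite /z /q; field; rewrite !lt0r_neq0.
have -> : t%:R = r - r / c * (r^-1 * c).
  have -> : r / c * (r^-1 * c) = 1.
    by rewrite mulrACA mulfV ?mulVf ?mul1r ?lt0r_neq0.
  by rewrite /r -[t.+1%:R]natr1 addrK.
rewrite [leRHS]mulrC; apply: ler_wpM2l; first exact: ltW.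
rewrite lerD2l lerN2; apply: ler_wpM2l hnum.
by rewrite divr_ge0 // ltW.
Qed.

(* Sets of size l are replaced by sets of size l.+1 through the local LYM
   inequality, so that one quadratic bound serves both sums. *)
Lemma heavy_bound_spread_small_cut : c <= 7 / 9 -> (6 <= l)%N ->
  \sum_(i < t.+1) heavy w U l (a i) + heavy w U l.+1 1 <= t%:R * M.
Proof.
move=> c7 l6.
have c23 : 2 / 3 <= c by apply: le_trans hA Ac.
have y0 : 0 < 2 * c - 1 by move: c23; lra.
have c0 : 0 < c by move: c23; lra.
have nz1 : 1 + l%:R != 0 :> R by rewrite nat1r pnatr_eq0.
have nz2 : 1 + t%:R != 0 :> R by rewrite nat1r pnatr_eq0.
(* The product [r * lam] is the ratio of the numbers of [l.+1]-sets and [l]-sets in [U], which is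
   also the factor in [heavy_lym]. *)
pose k : R := l.+1%:R; pose lam := (m%:R - l%:R) / (k * r).
pose CT : R := 'C(m, l.+1)%:R.
have k0 : 0 < k by rewrite ltr0n.
have l0 : 0 < l%:R :> R by rewrite ltr0n (leq_trans _ l3).
have lm' : l%:R < m%:R :> R by rewrite ltr_nat.
have rlam : r * lam = (m%:R - l%:R) / k.
  by rewrite /lam; field; rewrite ?nz1 ?nz2 ?lt0r_neq0.
have rlam0 : 0 < r * lam by rewrite rlam divr_gt0 // subr_gt0.
have lam0 : 0 <= lam by rewrite -(pmulr_rge0 _ r0) ltW.
have CTE : CT = r * lam * M.
  have := congr1 (fun n => n%:R : R) (bin_succ m l).
  rewrite !natrM natrB ?(ltnW lm) // -/k -/CT -/M rlam => h.
  by apply: (mulfI (lt0r_neq0 k0)); rewrite h; field; rewrite ?nz1 ?nz2 ?lt0r_neq0.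
have h1 : r * lam * \sum_(i < t.+1) heavy w U l (a i) <=
    \sum_(i < t.+1) heavy w U l.+1 (a i).
  rewrite mulr_sumr; apply: ler_sum => i _.
  rewrite rlam mulrAC ler_pdivrMr // -natrB ?(ltnW lm) // [leRHS]mulrC.
  exact: heavy_lym.
pose al := (c - A) / (c * (2 * c - 1)).
(* The least coefficient that [rank_quadratic] admits. *)
pose be := Num.max (c * (2 * c - 1))^-1 ((lam + A / c) / c).
have be0 : 0 <= be by rewrite le_max invr_ge0 ltW // mulr_gt0.
have h2 : \sum_(i < t.+1) heavy w U l.+1 (a i) + r * lam * heavy w U l.+1 1 <=
    \sum_(T in ksets U l.+1) r * (1 - A / c + al * wt w T + be * (2 * elsym w 2 T)).
  rewrite sum_rank /heavy mulr_sumr -big_split /=; apply: ler_sum => T.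
  rewrite in_ksets => /andP[TU _].
  apply: rank_quadratic => //; rewrite ?le_max ?lexx ?orbT ?wt_ge0 //.
  - by rewrite -/c; move: c23; lra.
  - by rewrite -/c; move: c23 hA; lra.
  - by rewrite mulr_ge0 ?elsym_ge0.
  - exact: elsym2_ge.
pose y : R := m%:R / (m%:R - 1).
(* From [l >= 6] follow [t + 1 >= 20] and then [m >= 200]. *)
have m100 : 100 <= m%:R - 1 :> R.
  have t20 : (20 <= t.+1)%N.
    rewrite ltnNge; apply/negP => t19.
    have l7 : (7 <= l.+1)%N by [].
    have := leq_trans (leq_mul (leqnn 25) l7) (leq_trans ht (leq_mul (leqnn 9) t19)).
    by [].
  have : (600 <= 3 * m)%N.
    by apply: leq_trans hm; rewrite (leq_mul2l 5 120) (leq_mul t20 l6).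
  by rewrite -(ler_nat R) natrM; lra.
have h3 : \sum_(T in ksets U l.+1) 2 * elsym w 2 T <=
    (r * A) ^+ 2 * (k * l%:R * CT / (m%:R * (m%:R - 1))).
  rewrite -mulr_sumr (sum_elsym _ _ (leqW (ltnW l3))) mulrA.
  have -> : 'C(#|U| - 2, l.+1 - 2)%:R = k * l%:R * CT / (m%:R * (m%:R - 1)) :> R.
    have := congr1 (fun n => n%:R : R) (bin_pred2 m (l - 1)).
    have e1 : (l - 1).+1 = l by rewrite subn1 prednK // (leq_trans _ l3).
    have e2 : (l.+1 - 2 = l - 1)%N by [].
    rewrite e2 !natrM e1 natrB ?(leq_ltn_trans _ lm) // -/m -/k -/CT => h.
    have mm0 : m%:R * (m%:R - 1) != 0 :> R.
      by rewrite mulf_neq0 ?lt0r_neq0 //; move: m100; lra.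
    by apply: (mulfI mm0); rewrite h [RHS]mulrC divfK.
  apply: ler_wpM2r => //; rewrite divr_ge0 ?mulr_ge0 // ?ltW //.
  by move: m100; lra.
have h4 : \sum_(T in ksets U l.+1) r * (1 - A / c + al * wt w T + be * (2 * elsym w 2 T))
    <= r * ((1 - A / c) * CT + al * (r * A * (k * CT / m%:R)) +
       be * ((r * A) ^+ 2 * (k * l%:R * CT / (m%:R * (m%:R - 1))))).
  set b0 := 1 - A / c.
  rewrite -mulr_sumr ler_pM2l // big_split big_split /= -!mulr_sumr sum_wt //.
  have -> : \sum_(T in ksets U l.+1) b0 = b0 * CT.
    by rewrite sumr_const card_ksets mulr_natr.
  by rewrite lerD2l ler_wpM2l // mulr_sumr.
pose z : R := l%:R * r / m%:R; pose z' : R := k * r / m%:R.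
have z0 : 0 <= z by rewrite !mulr_ge0 // ?invr_ge0 ltW.
have z'0 : 0 <= z' by rewrite !mulr_ge0 // ?invr_ge0 ltW.
have z3 : z <= 3 / 5.
  rewrite ler_pdivrMr // mulrC.
  by move: hm; rewrite -(ler_nat R) !natrM -/r; lra.
have l6' : 6 <= l%:R :> R by rewrite ler_nat.
have kE : k = l%:R + 1 by rewrite /k natr1.
have z'7 : z' <= 7 / 10.
  have : z' <= 7 / 6 * z.
    rewrite /z' /z mulrA ler_pM2r ?invr_gt0 // mulrA ler_pM2r // kE.
    by move: l6'; lra.
  by move: z3; lra.
have y1 : y <= 101 / 100.
  by rewrite ler_pdivrMr; move: m100; lra.
have y0' : 0 <= y by rewrite divr_ge0 //; move: m100; lra.
have hv : r^-1 <= 9 / 175.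
  rewrite -[r^-1]mul1r ler_pdivrMr //.
  have : 175 <= 9 * r.
    have l7 : (7 <= l.+1)%N by [].
    by rewrite -natrM ler_nat; exact: leq_trans (leq_mul (leqnn 25) l7) ht.
  by lra.
have hlam : lam * z' <= 1.
  have -> : lam * z' = (m%:R - l%:R) / m%:R.
    by rewrite /lam /z'; field; rewrite ?nz1 ?nz2 ?lt0r_neq0.
  by rewrite ler_pdivrMr // mul1r; move: l0; lra.
have hnum := small_cut_numerics hA Ac c7 z0 z3 z'0 z'7 y0' y1 hv lam0 hlam
  (erefl al) (erefl be).
rewrite -(ler_pM2l rlam0) mulrDr.
apply: (le_trans (lerD h1 (lexx _))); apply: (le_trans h2).
apply: (le_trans h4).
have -> : r * ((1 - A / c) * CT + al * (r * A * (k * CT / m%:R)) +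
    be * ((r * A) ^+ 2 * (k * l%:R * CT / (m%:R * (m%:R - 1))))) =
  r * CT * (1 - (A / c - al * (A * z') - be * (A ^+ 2 * (z' * z * y)))).
  rewrite /z' /z /y; field.
  by rewrite ?nz1 ?nz2 ?lt0r_neq0 //; move: m100; lra.
have -> : r * lam * (t%:R * M) = r * CT * (1 - r^-1).
  have -> : t%:R = r - 1 by rewrite /r -[t.+1%:R]natr1 addrK.
  by rewrite CTE; field; rewrite ?nz1 ?nz2 ?lt0r_neq0.
rewrite ler_pM2l ?lerD2l ?lerN2 // mulr_gt0 // CTE mulr_gt0 //.
Qed.

End Spread.

(** * Combination of the two methods *)

(* Too few disjoint l-sets for the matching argument to apply unconditionally:
   as n >= 2 k^2, this forces t to be large compared with l. *)
Lemma spread_parameters (l d t m : nat) :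
  (2 * l.+1 < 3 * d)%N -> (2 * (l.+1 + d) ^ 2 <= m + t.+1 + d)%N ->
  ((l.+1 + d) * t < m + t.+1 + d)%N -> (m < t.*2.+1 * l)%N ->
  [/\ (d <= l)%N, (3 <= l)%N, (5 * (t.+1 * l) <= 3 * m)%N,
      (25 * l.+1 <= 9 * t)%N & (l <= 5)%N -> (d = l)%N /\ (14 <= t)%N].
Proof.
move=> hd; rewrite -mul2n expnS expn1 => hn ht hm.
(* With [K = l + 1 + d], inserting [m < (2 * t + 1) * l] into [2 * K ^ 2 <= m + t + 1 + d] gives
   [K * (2 * K - 1) < t * (2 * l + 1)]. *)
have hK : ((l.+1 + d) * (2 * (l.+1 + d) - 1) < t * (2 * l + 1))%N by nia.
have hdl : (d <= l)%N by rewrite leqNgt; apply/negP => ld; nia.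
have h25 : (25 * l.+1 <= 9 * t)%N.
  rewrite leqNgt; apply/negP => h; nia.
have l3 : (3 <= l)%N by lia.
split => //; first by nia.
move=> l5; have dl : d = l by lia.
split => //; rewrite dl in hK.
(* Now [K = 2 * l + 1], so [hK] says that [t > 4 * l + 1 >= 13]. *)
have : ((2 * l + 1) * (4 * l + 1) < (2 * l + 1) * t)%N by nia.
by rewrite ltn_pmul2l //; lia.
Qed.

(** If [U] has room for [2 * t + 1] disjoint blocks, the matching argument applies, as
    [wt w U - a 0 < t]. Otherwise as many blocks as fit are used. If [wt w U - a 0] is too large for
    them, then [a 0] and the weight per threshold are at least [2 / 3], and the Markov-type bounds
    apply. *)
Lemma heavy_bound (R : realFieldType) (V : finType) (w : V -> R) (U : {set V})
    (a : nat -> R) t l d :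
  (2 * l.+1 < 3 * d)%N -> (2 * (l.+1 + d) ^ 2 <= #|U| + t.+1 + d)%N ->
  ((l.+1 + d) * t < #|U| + t.+1 + d)%N ->
  (forall v, 0 <= w v) -> (forall i j, (i <= j)%N -> a j <= a i) ->
  a 0%N <= 1 -> (forall v, v \in U -> w v <= 1 - a 0%N) ->
  wt w U < \sum_(i < t.+1) a i ->
  \sum_(i < t.+1) heavy w U l (a i) + heavy w U l.+1 1 <= t%:R * 'C(#|U|, l)%:R.
Proof.
move=> hd hn ht w0 a_anti a1 wa hU.
have hS (x : R) : (forall i, a i <= x) -> wt w U - a 0%N < t%:R * x.
  move=> hx; rewrite ltrBlDl (lt_le_trans hU) // big_ord_recl lerD2l.
  by rewrite -[t in leRHS]card_ord mulr_natl -sumr_const ler_sum.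
have [hm|hm] := leqP (t.*2.+1 * l) #|U|.
  apply: (@heavy_bound_matching _ _ _ _ _ _ _ t.*2.+1) => //.
    by rewrite ltnS -addnn leq_addr.
  have -> : (t.*2.+1 - t.+1 = t)%N by rewrite subSS -addnn addnK.
  rewrite -[t%:R]mulr1 ltW // hS // => i.
  exact: le_trans (a_anti _ _ (leq0n i)) a1.
have [dl l3 hm5 h25 h5] := spread_parameters hd hn ht hm.
have l0 : (0 < l)%N by apply: leq_trans l3.
pose tau := (#|U| %/ l)%N.
have htau : (t < tau)%N by rewrite leq_divRL //; nia.
have [hD|hD] := leP (wt w U - a 0%N) (tau - t.+1)%:R.
  by apply: (heavy_bound_matching _ _ _ _ htau) => //; apply: leq_trunc_div.
have hc := hS (a 0%N) (fun i => a_anti _ _ (leq0n i)).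
have hmt : (#|U| < l * tau + l)%N by rewrite mulnC addnC -mulSn ltn_ceil.
have hml : (l * t + d * t <= #|U| + d)%N by nia.
rewrite natrB // in hD.
have l0' : 0 < l%:R :> R by rewrite ltr0n.
have hlD : l%:R * (tau%:R - t.+1%:R) < l%:R * (wt w U - a 0%N) by rewrite ltr_pM2l.
set sg := wt w U in hD hc hlD.
have t1 : (t.+1%:R = t%:R + 1 :> R) by rewrite natr1.
have l1 : (l.+1%:R = l%:R + 1 :> R) by rewrite natr1.
have h1 : d%:R * t%:R + 1 <= l%:R * (sg - a 0%N) + 2 * l%:R + d%:R :> R.
  have : (l * t + d * t + 1 <= l * tau + l + d)%N by lia.
  rewrite -(ler_nat R) !natrD !natrM => h; move: hlD h; rewrite t1; lra.
have t0 : (0 < t)%N by move: h25; clear; lia.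
have t0' : 0 < t%:R :> R by rewrite ltr0n.
(* Multiply [h1] by 3, replace [3 * d] by [2 * l + 3], and absorb the loss by [8 * l <= 3 * t]. *)
have h2 : 2 * t%:R <= 3 * (sg - a 0%N).
  have h3d : (2 * l + 3 <= 3 * d)%N by move: hd; clear; lia.
  have h8 : (8 * l <= 3 * t)%N by move: h25; clear; lia.
  rewrite -(ler_pM2l l0').
  have : (2 * l + 3)%:R * (t - 1)%:R <= (3 * d)%:R * (t - 1)%:R :> R.
    by rewrite ler_wpM2r // ler_nat.
  move: h8; rewrite -(ler_nat R) !natrM natrD natrM (natrB _ t0).
  move: h1; lra.
have c23 : 2 / 3 < a 0%N by rewrite -(ltr_pM2l t0'); move: h2 hc; lra.
have hA : 2 / 3 <= sg / t.+1%:R.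
  by rewrite ler_pdivlMr ?ltr0n // t1; move: h2 c23; lra.
have ht9 : (25 * l.+1 <= 9 * t.+1)%N by apply: leq_trans h25 _; rewrite leq_mul2l leqnSn.
have [c7|c7] := leP (7 / 9) (a 0%N).
  exact: heavy_bound_spread_large_cut.
apply: heavy_bound_spread_small_cut => //; first exact: ltW.
(* For [l <= 5] one has [d = l], hence [t - 3 < wt w U - a 0 < 7 * t / 9], which contradicts
   [t >= 14]. *)
rewrite ltnNge; apply/negP => /h5[dE t14].
have h3 : t%:R - 3 < sg - a 0%N.
  rewrite -(ltr_pM2l l0'); move: h1; rewrite dE; lra.
have h4 : t%:R * a 0%N <= t%:R * (7 / 9) by rewrite ler_wpM2l // ltW.
have : 14 <= t%:R :> R by rewrite ler_nat.
move: h3 h4 hc; lra.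
Qed.

(** * Counting light sets *)

Lemma split_heaviest (R : realFieldType) (V : finType) (w : V -> R)
    (W : {set V}) r :
  (0 < r <= #|W|)%N ->
  exists (U : {set V}) (v : nat -> V),
    [/\ U \subset W /\ (#|U| + r = #|W|)%N,
        forall i, (i < r)%N -> v i \in W :\: U,
        forall i j, (i < r)%N -> (j < r)%N -> v i = v j -> i = j,
        forall i j, (i <= j)%N -> w (v i) <= w (v j) &
        forall x y, x \in U -> y \in W :\: U -> w x <= w y].
Proof.
move=> /andP[r0 rW].
have [x0 _] : exists x0, x0 \in W by apply/card_gt0P; apply: leq_trans rW.
pose le_w : rel V := fun x y => w x <= w y.
have le_w_tr : transitive le_w by move=> y x z; apply: le_trans.
have le_w_refl : reflexive le_w by move=> x; apply: lexx.
pose s := sort le_w (enum W).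
have s_sorted : sorted le_w s by apply: sort_sorted => x y; apply: le_total.
have s_size : size s = #|W| by rewrite size_sort cardE.
have s_uniq : uniq s by rewrite sort_uniq enum_uniq.
have s_mem x : (x \in s) = (x \in W) by rewrite mem_sort mem_enum.
(* The index is capped at the last position so that the weights are monotone along all natural
   numbers. *)
pose m := (#|W| - r)%N; pose u i := nth x0 s (minn i (#|W| - 1)).
have u_lt i : (minn i (#|W| - 1) < size s)%N by rewrite s_size; lia.
have u_le i j : (i <= j)%N -> w (u i) <= w (u j).
  move=> ij; apply: (sorted_leq_nth le_w_tr le_w_refl) => //; rewrite ?inE //.
  by lia.
have u_inj i j : (i < #|W|)%N -> (j < #|W|)%N -> u i = u j -> i = j.
  move=> iW jW /eqP; rewrite nth_uniq // => /eqP; lia.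
pose U := [set x in take m s].
have hU x : x \in U -> exists2 i, (i < m)%N & x = u i.
  rewrite inE => /(nthP x0)[i]; rewrite size_takel ?s_size ?leq_subr // => im <-.
  by exists i; rewrite ?nth_take // /u; congr nth; lia.
exists U, (fun i => u (m + i)%N); split.
- split; first by apply/subsetP => x; rewrite inE => /mem_take; rewrite s_mem.
  rewrite cardsE (card_uniqP _) ?take_uniq // size_takel ?s_size ?leq_subr //.
  by rewrite subnK.
- move=> i ir; rewrite inE -s_mem mem_nth // andbT; apply/negP => /hU[j jm].
  by move=> /u_inj; lia.
- by move=> i j ir jr /u_inj; lia.
- by move=> i j ij; apply: u_le; rewrite leq_add2l.
- move=> x y /hU[i im ->]; rewrite !inE -s_mem => /andP[yU /(nthP x0)[j js yE]].
  have -> : y = u j.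
    by rewrite -yE /u; congr nth; move: js; rewrite s_size; lia.
  apply: u_le; apply: leq_trans (ltnW im) _; rewrite leqNgt; apply/negP => jm.
  have sm : size (take m s) = m by rewrite size_takel // s_size leq_subr.
  have := mem_nth x0 (s := take m s) (n := j); rewrite sm nth_take // yE => /(_ jm).
  by rewrite (negbTE yU).
Qed.

Definition light (R : realFieldType) (V : finType) (w : V -> R) (U : {set V})
    k (x : R) : {set {set V}} := [set G in ksets U k | wt w G < x].

Lemma card_light (R : realFieldType) (V : finType) (w : V -> R) (U : {set V})
    k (x : R) : #|light w U k x|%:R = 'C(#|U|, k)%:R - heavy w U k x.
Proof.
apply/eqP; rewrite eq_sym subr_eq -card_ksets -sum1_card natr_sum.
rewrite -sum1_card natr_sum [X in _ == X + _]big_mkcond /=.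
rewrite [X in X == _]big_mkcond /heavy [X in _ == _ + X]big_mkcond -big_split /=.
apply/eqP; apply: eq_bigr => G _; rewrite !inE.
case: (_ && _) => /=; last by rewrite addr0.
by have [|] := ltP (wt w G) x; rewrite ?addr0 ?add0r.
Qed.

(** Only sets with at most one vertex [v i] are counted: [None] indexes those inside [U], and
    [Some i] those of the form [v i |: G]. *)
Lemma light_split (R : realFieldType) (V : finType) (w : V -> R)
    (U W : {set V}) (v : nat -> V) r l (x : R) :
  U \subset W -> (forall i, (i < r)%N -> v i \in W :\: U) ->
  (forall i j, (i < r)%N -> (j < r)%N -> v i = v j -> i = j) ->
  (#|light w U l.+1 x| + \sum_(i < r) #|light w U l (x - w (v i))| <=
   #|light w W l.+1 x|)%N.
Proof.
move=> UW vWU v_inj.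
pose D (o : option 'I_r) : {set {set V}} :=
  if o is Some i then light w U l (x - w (v i)) else light w U l.+1 x.
pose f (p : option 'I_r * {set V}) :=
  if p.1 is Some i then v i |: p.2 else p.2.
have vU (i : 'I_r) (G : {set V}) : G \subset U -> v i \notin G.
  move=> /subsetP GU; have := vWU i (ltn_ord i); rewrite inE => /andP[viU _].
  by apply: contra viU => /GU.
have DU o (G : {set V}) : G \in D o -> G \subset U.
  by case: o => [i|]; rewrite !inE => /andP[/andP[]].
have cD : #|[set p | p.2 \in D p.1]| =
    (#|light w U l.+1 x| + \sum_(i < r) #|light w U l (x - w (v i))|)%N.
  rewrite -sum1_card (eq_bigl (fun p => xpredT p.1 && (p.2 \in D p.1))); last first.
    by move=> p; rewrite inE.
  rewrite -(pair_big_dep xpredT (fun o G => G \in D o) (fun _ _ => 1%N)) /=.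
  rewrite (bigD1 None) //= sum1_card; congr (_ + _)%N.
  rewrite (reindex_omap Some id) => [|[]//] /=.
  by apply: eq_big => [i|i _]; rewrite ?eqxx ?sum1_card.
rewrite -cD -(card_in_imset (f := f)) => [|p q].
  apply: subset_leq_card; apply/subsetP => _ /imsetP[[[i|] G] hG ->]; move: hG.
    rewrite !inE /= => /andP[/andP[GU /eqP cG] wG]; rewrite /f /=.
    have := vWU i (ltn_ord i); rewrite inE => /andP[viU viW].
    rewrite subUset sub1set viW (subset_trans GU UW) cardsU1 (vU _ _ GU) cG eqxx /=.
    by rewrite /wt big_setU1 ?vU //= -ltrBrDl.
  rewrite !inE /= => /andP[/andP[GU cG] wG].
  by rewrite /f /= (subset_trans GU UW) cG.
case: p q => [[i|] G] [[j|] H] /[1!in_set] hG /[1!in_set] hH;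
  rewrite /f /= => eGH.
- have GU := DU (Some i) G hG; have HU := DU (Some j) H hH.
  have : v i \in v j |: H by rewrite -eGH setU11.
  rewrite !inE (negbTE (vU i H HU)) orbF => /eqP vij.
  have ij : i = j.
    by apply: val_inj; apply: v_inj (ltn_ord i) (ltn_ord j) vij.
  subst j; congr (_, _).
  by rewrite -(setU1K (vU i G GU)) eGH setU1K ?vU.
- by have := vU i H (DU None H hH); rewrite -eGH setU11.
- by have := vU j G (DU None G hG); rewrite eGH setU11.
- by rewrite eGH.
Qed.

Lemma light_count (R : realFieldType) (V : finType) (w : V -> R) (W : {set V})
    t l d :
  (2 * l.+1 < 3 * d)%N -> (2 * (l.+1 + d) ^ 2 <= #|W| + d)%N ->
  ((l.+1 + d) * t < #|W| + d)%N -> (forall v, 0 <= w v) ->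
  wt w W < t.+1%:R ->
  ('C(#|W| - t, l.+1) <= #|light w W l.+1 1|)%N.
Proof.
move=> hd hn ht w0 hw.
have tW : (t < #|W|)%N.
  have [t0|t0] := leqP t 0; last by nia.
  by move: t0; rewrite leqn0 => /eqP ->; nia.
have [//|U [v [[UW cU] vWU v_inj v_le vU]]] := @split_heaviest R V w W t.+1.
pose a i := 1 - w (v i).
have hU : wt w U < \sum_(i < t.+1) a i.
  rewrite sumrB sumr_const card_ord ltrBrDl; apply: le_lt_trans hw.
  rewrite (wt_setD w UW) addrC; apply: lerD => //.
  have -> : \sum_(i < t.+1) w (v i) = wt w [set v (i : 'I_t.+1) | i in setT].
    rewrite /wt big_imset /= => [|i j _ _ /v_inj h]; last by apply: val_inj; apply: h.
    by apply: eq_bigl => i; rewrite inE.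
  by apply: wt_le => //; apply/subsetP => _ /imsetP[i _ ->]; apply: vWU.
have := heavy_bound (w := w) (U := U) (a := a) (t := t) (l := l) hd.
rewrite cU => /(_ hn ht w0).
have a_anti i j : (i <= j)%N -> a j <= a i by move=> ij; rewrite lerD2l lerN2 v_le.
have a1 : a 0%N <= 1 by rewrite gerBl.
have wU x : x \in U -> w x <= 1 - a 0%N by move=> xU; rewrite subKr vU // vWU.
move=> /(_ a_anti a1 wU hU) hb.
have hl := @light_split R V w U W v t.+1 l 1 UW vWU v_inj.
apply: leq_trans hl; rewrite -(ler_nat R) natrD natr_sum card_light.
rewrite (eq_bigr (fun i : 'I_t.+1 => 'C(#|U|, l)%:R - heavy w U l (a i))) => [|i _]; last first.
  by rewrite card_light.
rewrite sumrB sumr_const card_ord -[_ *+ t.+1]mulr_natl.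
(* By Pascal's rule the target is ['C(#|U|, l.+1) + 'C(#|U|, l)], so the heavy sets may use up [t]
   of the [t + 1] copies of ['C(#|U|, l)]. *)
have -> : (#|W| - t = #|U|.+1)%N by lia.
rewrite binS natrD -[t.+1%:R]natr1; move: hb; lra.
Qed.

(** * From a fractional cover to the link of the lightest vertices *)

Lemma cover_link_bound (R : realFieldType) (V : finType) (w : V -> R)
    (s : R) K d t :
  (2 * K < 5 * d)%N -> (d < K)%N -> (2 * K ^ 2 <= #|V|)%N -> (K * t < #|V|)%N ->
  0 < s -> s <= t.+1%:R -> K%:R * s <= #|V|%:R ->
  (forall v, 0 <= w v) -> \sum_v w v < s ->
  exists2 D : {set V}, #|D| = d &
    (#|[set T in ksets (~: D) (K - d) | (1 <= wt w (T :|: D))%R]| +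
     'C(#|V| - d - t, K - d) <= 'C(#|V| - d, K - d))%N.
Proof.
move=> hd dK hn ht s0 st Ks w0 hw.
have d0 : (0 < d)%N by lia.
have Kn : (K < #|V|)%N.
  by apply: leq_trans hn; rewrite expnS expn1; nia.
have [l Kd] : exists l, (K - d)%N = l.+1.
  by exists (K - d).-1; rewrite prednK // subn_gt0.
have KE : K = (l.+1 + d)%N by rewrite -Kd subnK // ltnW.
have h3d : (2 * l.+1 < 3 * d)%N by move: hd KE; clear; lia.
have dn : (d <= #|V|)%N by rewrite ltnW // (ltn_trans dK).
have hr : (0 < #|V| - d <= #|[set: V]|)%N 
  by rewrite cardsT leq_subr subn_gt0 (ltn_trans dK).
have [D [v [[_]]]] := split_heaviest w hr; rewrite cardsT => cD _ _ _ D_le.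
have cDd : #|D| = d.
  by apply/eqP; rewrite -(eqn_add2r (#|V| - d)) cD subnKC.
exists D => //; have cDC : #|~: D| = (#|V| - d)%N by rewrite cardsCs setCK cDd.
(* An edge of weight at least 1 containing [D] keeps at least [g] outside [D] when [b] is subtracted
   from every weight; hence the scaling by [g]. *)
pose b := wt w D / d%:R; pose g := 1 - K%:R * b.
have d0' : 0 < d%:R :> R by rewrite ltr0n.
have bd : wt w D = d%:R * b by rewrite mulrC divfK // gt_eqF.
have b_le x : x \in ~: D -> b <= w x.
  rewrite inE => xD; rewrite ler_pdivrMr // mulrC mulr_natl -cDd -sumr_const.
  by apply: ler_sum => y yD; apply: D_le; rewrite ?inE ?xD.
have b0 : 0 <= b by rewrite divr_ge0 // wt_ge0.
have wsum : \sum_v w v = wt w D + wt w (~: D).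
  rewrite -setTD -wt_setD ?subsetT // /wt.
  by apply: eq_bigl => x; rewrite inE.
have nd : (#|V| - d)%:R = #|V|%:R - d%:R :> R by rewrite natrB.
have nb : #|V|%:R * b <= \sum_v w v.
  have : (#|V| - d)%:R * b <= wt w (~: D).
    by rewrite -cDC mulr_natl -sumr_const; apply: ler_sum.
  by rewrite wsum bd nd; lra.
have n0 : 0 < #|V|%:R :> R by rewrite ltr0n (leq_trans _ Kn).
have K0 : 0 < K%:R :> R by rewrite ltr0n (leq_trans _ dK).
(* The mean [b] over the lightest vertices is at most the overall mean, which is less than
   [s / #|V| <= 1 / K]. *)
have g0 : 0 < g.
  rewrite subr_gt0 -(ltr_pM2l n0) mulr1 mulrCA (lt_le_trans _ Ks) //.
  by rewrite ltr_pM2l // (le_lt_trans nb).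
pose w' x := if x \in ~: D then (w x - b) / g else 0.
have w'0 x : 0 <= w' x.
  by rewrite /w'; case: ifP => // xD; rewrite divr_ge0 ?(ltW g0) // subr_ge0 b_le.
have w'E (T : {set V}) : T \subset ~: D -> wt w' T = (wt w T - #|T|%:R * b) / g.
  move=> TD; rewrite /wt (eq_bigr (fun x => (w x - b) / g)) => [|x xT].
    by rewrite -mulr_suml sumrB sumr_const mulr_natl.
  by rewrite /w' (subsetP TD).
(* The shifted total is less than [s - #|V| * b], which is at most [s * g] since [K * s <= #|V|]. *)
have hw' : wt w' (~: D) < t.+1%:R.
  rewrite w'E // ltr_pdivrMr // cDC; apply: (@lt_le_trans _ _ (s * g)); last first.
    by rewrite ler_pM2r.
  have : s * (K%:R * b) <= #|V|%:R * b by rewrite mulrCA mulrA ler_wpM2r.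
  move: hw; rewrite wsum bd nd /g; lra.
have hc := @light_count R V w' (~: D) t l d.
rewrite cDC Kd -cDC -card_ksets cDC in hc *.
set S := [set T in _ | _].
apply: (@leq_trans (#|S| + #|light w' (~: D) l.+1 1|)).
  rewrite leq_add2l; by apply: hc; rewrite ?subnK -?KE.
rewrite -cardsUI [#|S :&: _|]eq_card0 ?addn0.
  by apply: subset_leq_card; apply/subsetP => T; rewrite !inE => /orP[] /andP[].
move=> T; rewrite !inE; apply/negbTE/negP => /andP[].
move=> /andP[/andP[TD /eqP cT] T1] /andP[_]; apply/negP; rewrite -leNgt.
rewrite w'E // ler_pdivlMr // mul1r cT.
have TDT : (T :|: D) :\: D = T.
  by rewrite setDUl setDv setU0 (setDidPl _) // disjoints_subset.
by move: T1; rewrite (wt_setD w (subsetUr T D)) TDT bd /g KE natrD; lra.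
Qed.

(** * Minimum degree and the extremal construction *)

Lemma min_degree_le k d (H : kgraph k) (S : {set H}) :
  #|S| = d -> (min_degree d H <= degree S)%N.
Proof.
move=> /eqP cS; rewrite /min_degree.
elim: (index_enum _) (mem_index_enum S) => // S' r IHr; rewrite inE big_cons.
case/predU1P => [<-|/IHr hr]; first by rewrite cS geq_minl.
by case: ifP => // _; apply: leq_trans (geq_minr _ _) hr.
Qed.

Lemma degree_le_edges k (H : kgraph k) (S : {set H}) :
  (degree S <= #|edges H|)%N.
Proof.
rewrite /degree -(card_in_imset (f := fun T : {set H} => T :|: S)) => [|A B].
  apply: subset_leq_card; apply/subsetP => _ /imsetP[T + ->].
  by rewrite inE => /andP[].
have K (T : {set H}) : T \subset ~: S -> (T :|: S) :\: S = T.
  by move=> TS; rewrite setDUl setDv setU0 (setDidPl _) // disjoints_subset.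
rewrite !inE => /andP[AS _] /andP[BS _] eAB.
by rewrite -(K A AS) eAB K.
Qed.

(** The default value [#|edges H|] is also at least [m], because it bounds the degree of some
    [d]-set. *)
Lemma le_min_degree k d (H : kgraph k) m : (d <= #|H|)%N ->
  (forall S : {set H}, #|S| = d -> (m <= degree S)%N) ->
  (m <= min_degree d H)%N.
Proof.
move=> dH hS; rewrite /min_degree; elim/big_ind: _ => [|x y mx my|S /eqP /hS//].
  have [|S] := set0Pn (ksets [set: H] d) _.
    by rewrite -card_gt0 card_ksets bin_gt0 cardsT.
  rewrite in_ksets => /andP[_ /eqP /hS hm].
  exact: leq_trans hm (degree_le_edges S).
by rewrite leq_min mx.
Qed.

Definition hitting_edges (V : finType) (S0 : {set V}) k : {set {set V}} :=
  [set e in ksets [set: V] k | ~~ [disjoint e & S0]].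

Lemma hitting_uniform (V : finType) (S0 : {set V}) k e :
  e \in hitting_edges S0 k -> #|e| = k.
Proof. by rewrite inE => /andP[]; rewrite in_ksets => /andP[_ /eqP]. Qed.

Definition hitting_graph (V : finType) (S0 : {set V}) k : kgraph k :=
  KGraph (@hitting_uniform V S0 k).

(** If [S] meets [S0], its link is complete; otherwise the link lacks exactly the sets avoiding
    [S0]. The additive form avoids truncated subtraction. *)
Lemma hitting_min_degree (V : finType) (S0 : {set V}) k d :
  (d <= k)%N -> (d <= #|V|)%N ->
  ('C(#|V| - d, k - d) <=
   min_degree d (hitting_graph S0 k) + 'C(#|V| - d - #|S0|, k - d))%N.
Proof.
move=> dk dV; rewrite addnC -leq_subLR; apply: le_min_degree => // S cS.
rewrite leq_subLR.
have cSC : #|~: S| = (#|V| - d)%N by rewrite cardsCs setCK cS.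
have in_nb (T : {set V}) : T \in ksets (~: S) (k - d) ->
    ~~ [disjoint T :|: S & S0] ->
    T \in neighbours (S : {set hitting_graph S0 k}).
  rewrite in_ksets => /andP[TS /eqP cT] hT.
  rewrite !inE TS hT subsetT andbT /= cardsU cS cT.
  have -> : T :&: S = set0.
    by apply/eqP; rewrite setI_eq0 disjoints_subset.
  by rewrite cards0 subn0 subnK.
rewrite -cSC -card_ksets.
have [dS|hS] := boolP [disjoint S & S0]; last first.
  rewrite addnC; apply: leq_trans (leq_addr _ _); apply: subset_leq_card.
  apply/subsetP => T /in_nb; apply; apply: contra hS.
  by apply: disjointWl; apply: subsetUr.
have -> : (#|~: S| - #|S0| = #|~: S :\: S0|)%N.
  rewrite cardsD (setIidPr _) // -disjoints_subset disjoint_sym //.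
rewrite -card_ksets addnC.
apply: leq_trans (leq_card_setU _ _); apply: subset_leq_card.
apply/subsetP => T hT; rewrite inE.
have [dT|/(in_nb T hT) ->//] := boolP [disjoint T :|: S & S0].
rewrite orbC in_ksets subsetD; move: hT; rewrite in_ksets => /andP[-> ->].
by rewrite (disjointWl (subsetUl T S) dT).
Qed.

(** [S0] meets every edge, so each edge can be charged to its vertices in [S0], which carry a load
    of at most 1 each. *)
Lemma hitting_matching_size (R : realType) (V : finType) (S0 : {set V}) k
    (f : {set hitting_graph S0 k} -> R) :
  fractional_matching f -> matching_size f <= #|S0|%:R.
Proof.
move=> [f01 fv]; rewrite /matching_size.
apply: (@le_trans _ _ (\sum_(e in edges (hitting_graph S0 k))
    \sum_(v in S0 | v \in e) f e)).
  apply: ler_sum => e eE; have /andP[f0 _] := f01 e eE.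
  move: (eE); rewrite inE => /andP[_].
  rewrite -setI_eq0 => /set0Pn[v]; rewrite inE => /andP[ve vS].
  by rewrite (bigD1 v) ?vS //= lerDl sumr_ge0.
rewrite (exchange_big_dep (mem S0)) /= => [|e v _ /andP[]//].
rewrite -sumr_const; apply: ler_sum => v vS; apply: le_trans (fv v).
by rewrite le_eqVlt; apply/orP; left; apply/eqP; apply: eq_bigl => e; rewrite vS.
Qed.

Theorem theorem1p1 (R : realType) (k d : nat)
    (hk : (4 <= k)%N) (hd : (2 * k < 5 * d)%N) (hdk : (d <= k - 1)%N) :
  exists s0 : rat,
    [/\ (k <= 2 * d)%N -> s0 = 0,
        (2 * d < k)%N -> s0 = 1 &
        forall (n : nat) (s : rat),
          (2 * k ^ 2 <= n)%N -> 0 < s -> s0 < s -> s <= n%:R / k%:R ->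
          is_threshold R d s k n
            ('C(n - d, k - d)%:Z
             - 'C(n - d - (`|Num.ceil s| - 1), k - d)%:Z + 1)].
Proof.
exists (if (k <= 2 * d)%N then 0 else 1); split => [->//|hk2|n s hn s0 _ sn].
  by rewrite leqNgt hk2.
have dk : (d < k)%N by rewrite -ltnS; move: hdk hk; clear; lia.
have kn : (k <= n)%N.
  by apply: leq_trans hn; rewrite expnS expn1; move: hk; clear; nia.
set t := (`|Num.ceil s| - 1)%N.
have c0 : 0 < Num.ceil s by rewrite ceil_gt0.
have ceilE : Num.ceil s = t.+1%:Z by move: c0; rewrite /t; lia.
have /andP[ts st] := ceil_itv s.
rewrite ceilE -pmulrn in st; rewrite ceilE in ts.
have {}ts : t%:R < s.
  by move: ts; rewrite (_ : t.+1%:Z - 1 = t%:Z) ?pmulrn //; lia.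
have k0 : 0 < k%:R :> rat by rewrite ltr0n (leq_trans _ hk).
have ks : k%:R * s <= n%:R by rewrite mulrC -ler_pdivlMr.
have kt : (k * t < n)%N.
  by rewrite -(ltr_nat rat) natrM (lt_le_trans _ ks) // ltr_pM2l.
have tsR : t%:R < ratr s :> R by rewrite -[t%:R]ratr_nat ltr_rat.
have stR : ratr s <= t.+1%:R :> R by rewrite -[t.+1%:R]ratr_nat ler_rat.
have ksR : k%:R * ratr s <= n%:R :> R.
  by rewrite -[k%:R]ratr_nat -rmorphM -[n%:R]ratr_nat ler_rat.
have s0R : 0 < ratr s :> R by rewrite ltr0q.
split=> [H cH hm|m' hm'].
- have E0 : set0 \notin edges H.
    apply/negP => /edges_uniform; rewrite cards0 => k00.
    by move: hk; rewrite -k00.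
  have [[f [f01 fv fs]]|[w [w0 we ws]]] :=
    fractional_matching_or_cover s0R E0; first by exists f.
  have absurd (a b c x : nat) : a%:Z - b%:Z + 1 <= c%:Z ->
      (x + b <= a)%N -> (c <= x)%N -> False by clear; lia.
  exfalso.
  (* The cover yields a [d]-set [D] whose link is too small for the assumed minimum degree. *)
  have [|||||||D cD hD] := @cover_link_bound R H w (ratr s) k d t hd dk;
    rewrite ?cH //.
  rewrite cH in hD.
  apply: (absurd _ _ _ _ hm hD).
  apply: leq_trans (min_degree_le cD) _; apply: subset_leq_card.
  apply/subsetP => T; rewrite !inE => /andP[TD TE]; rewrite TD we //= andbT.
  have := edges_uniform TE; rewrite cardsU cD.
  have -> : T :&: D = set0 by apply/eqP; rewrite setI_eq0 disjoints_subset.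
  by rewrite cards0 subn0 => /(congr1 (subn^~ d)); rewrite /= addnK => ->.
- have tn : (t <= n)%N by move: kt hk; clear; nia.
  (* For the lower bound, take all [k]-sets meeting [t] fixed vertices: a fractional matching then
     has size at most [t < s]. *)
  pose S0 : {set 'I_n} := [set i : 'I_n | (i < t)%N].
  have cS0 : #|S0| = t.
    rewrite -[RHS]card_ord -[RHS]sum1_card (big_ord_widen n (fun=> 1%N) tn).
    by rewrite -sum1_card; apply: eq_bigl => i; rewrite inE.
  have hdeg := @hitting_min_degree 'I_n S0 k d (ltnW dk) _.
  rewrite card_ord cS0 in hdeg.
  rewrite leNgt; apply/negP => hlt.
  have [||f [fm fs]] := hm' (hitting_graph S0 k); rewrite ?card_ord //.
    by have := hdeg (leq_trans (ltnW dk) kn); move: hlt; lia.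
  have := hitting_matching_size fm; rewrite fs cS0; apply/negP.
  by rewrite -ltNge.
Qed.
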